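(* Let $\mathcal{M}=(M_k)_{k\ge 0}$ be a regular sequence and $m_k=M_k/k!$. Let $U\subset\mathbb{R}^d$ be an open neighbourhood of the origin and let $X=(X_1,\dots,X_m)$ be an ordered set of pairwise commuting $\mathcal{C}^\infty$-smooth complex vector fields in $U$. Define $\mathcal{C}^\infty$-smooth complex vector fields in $U\times\mathbb{R}^m$ by $$L_j=\frac{\partial}{\partial v_j}-X_j,\qquad 1\le j\le m,$$ where $v_j$ is the $j$-th coordinate of the second factor of $U\times\mathbb{R}^m$. If $f\in\mathcal{C}^{\mathcal{M}}(U,X)$, then for every open set $V\Subset U$ there exist $\delta,Q>0$ and $F\in\mathcal{C}(V\times\mathbb{R}^m)\cap\mathcal{C}^\infty\big(V\times(\mathbb{R}^m\setminus\{0\})\big)$ such that $$F(u,0)=f(u),\quad u\in V,$$ $$|L_jF(u,v)|\le Q^{k+1}m_k|v|^k,\qquad u\in V,\ 0<|v|<\delta,\ k\in\mathbb{Z}_+,\ 1\le j\le m.$$ Furthermore, for every $\kappa\in\mathbb{Z}_+$ one can choose $F$ such that for every $\gamma\in\mathbb{Z}_+^m$ with $|\gamma|\le\kappa$ the function $v\mapsto X^\gamma F(u,v)$ is $\mathcal{C}^\infty$-smooth for every $u\in V$. If $\mathcal{M}$ has moderate growth, then $F$ can be chosen such that $v\mapsto X^\gamma F(u,v)$ is $\mathcal{C}^\infty$-smooth for every $u\in V$ and every $\gamma\in\mathbb{Z}_+^m$.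
   Context: $\mathbb{Z}_+=\{0,1,2,\dots\}$. A sequence $\mathcal{M}=(M_k)_{k=0}^\infty$ of non-negative numbers is regular if, with $m_k=M_k/k!$: (a) $m_0=m_1=1$; (b) $m_k^2\le m_{k-1}m_{k+1}$ for $k\ge1$; (c) $\sup_{k\ge 1}(m_{k+1}/m_k)^{1/k}<\infty$; (d) $\lim_{k\to\infty} m_k^{1/k}=\infty$. It has moderate growth if in addition $\sup_k\big(M_k/\min_{0\le n\le k}M_nM_{k-n}\big)^{1/(k+1)}<\infty$. For an open set $U$ in Euclidean space and an ordered set $X=(X_1,\dots,X_m)$ of commuting $\mathcal{C}^\infty$-smooth complex vector fields in $U$, $\mathcal{C}^{\mathcal{M}}(U,X)$ is the space of all $f\in\mathcal{C}^\infty(U)$ such that for every compact $K\subset U$ there is $C>0$ with $\sup_K|X^\alpha f|\le C^{|\alpha|+1}M_{|\alpha|}$ for every $\alpha\in\mathbb{Z}_+^m$, where $X^\alpha=X_1^{\alpha_1}\circ\cdots\circ X_m^{\alpha_m}$. In $L_j$ and $X^\gamma F(u,v)$ the fields $X_j$ act in the variable $u$. $V\Subset U$ means that $\overline V$ is compact and contained in $U$. *)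

(* Defs.v *)
From HB Require Import structures.
From mathcomp Require Import all_boot all_order all_algebra.
From mathcomp Require Export complex.
From mathcomp Require Import all_classical all_reals all_analysis.

Set Implicit Arguments.
Unset Strict Implicit.
Unset Printing Implicit Defensive.

Import Order.TTheory GRing.Theory Num.Theory.
Import numFieldNormedType.Exports.

Local Open Scope classical_set_scope.
Local Open Scope ring_scope.
Local Open Scope complex_scope.

Definition wquot (R : realType) (M : nat -> R) (k : nat) : R := M k / k`!%:R.

(* [a `^ x] is the real power of a nonnegative base. *)
Definition regular (R : realType) (M : nat -> R) : Prop :=
  let m := wquot M in
  [/\ forall k, 0 <= M k,
      m 0%N = 1 /\ m 1%N = 1,
      forall k, (0 < k)%N -> m k ^+ 2 <= m k.-1 * m k.+1,
      has_ubound [set (m k.+1 / m k) `^ (k%:R^-1) | k in [set k | (0 < k)%N]]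
    & (fun k : nat => m k `^ (k%:R^-1)) @ \oo --> +oo].

(* The default value of the big minimum is its term of index 0. *)
Definition moderate_growth (R : realType) (M : nat -> R) : Prop :=
  has_ubound (range (fun k : nat =>
    (M k / \big[Num.min/(M 0%N * M k)]_(n < k.+1) (M n * M (k - n)%N))
      `^ (k.+1%:R^-1))).

(* Complex-valued functions on a real normed space. R[i] carries no topology
   over R in the libraries, so continuity and (real) differentiation are taken
   on the real and imaginary parts. *)

Definition ccontinuous_at (R : realType) (E : normedModType R)
    (g : E -> R[i]) (x : E) : Prop :=
  {for x, continuous (fun y => complex.Re (g y))} /\
  {for x, continuous (fun y => complex.Im (g y))}.

Definition cderivable (R : realType) (E : normedModType R)
    (g : E -> R[i]) (x w : E) : Prop :=
  derivable (fun y => complex.Re (g y)) x w /\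
  derivable (fun y => complex.Im (g y)) x w.

Definition cderive (R : realType) (E : normedModType R)
    (w : E) (g : E -> R[i]) (x : E) : R[i] :=
  'D_w (fun y => complex.Re (g y)) x +i* 'D_w (fun y => complex.Im (g y)) x.

(* [cderives [:: w1; ...; wn] g] is D_w1 (D_w2 (... (D_wn g))). *)
Definition cderives (R : realType) (E : normedModType R)
    (s : seq E) (g : E -> R[i]) : E -> R[i] :=
  foldr (fun w h => cderive w h) g s.

Definition ccontinuous_on (R : realType) (E : normedModType R)
    (W : set E) (g : E -> R[i]) : Prop :=
  forall x, W x -> ccontinuous_at g x.

(* C^infty-smoothness on an open set W of a finite-dimensional space E: the
   derivatives of all orders, in all directions, exist and are continuous on W.
   Functions are total; the values of g outside W play no role, W being open. *)
Definition smooth_on (R : realType) (E : normedModType R)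
    (W : set E) (g : E -> R[i]) : Prop :=
  forall s : seq E,
    ccontinuous_on W (cderives s g) /\
    forall x w, W x -> cderivable (cderives s g) x w.

(* The row A u stands for the complex vector field sum_i (A u)_i d/du_i. *)

Definition smooth_vfield (R : realType) (d : nat) (U : set 'rV[R]_d)
    (A : 'rV[R]_d -> 'rV[R[i]]_d) : Prop :=
  forall i : 'I_d, smooth_on U (fun u => A u 0 i).

Definition vfield_act (R : realType) (d : nat) (A : 'rV[R]_d -> 'rV[R[i]]_d)
    (g : 'rV[R]_d -> R[i]) (u : 'rV[R]_d) : R[i] :=
  \sum_(i < d) A u 0 i * cderive (delta_mx 0 i) g u.

Definition commuting_on (R : realType) (d : nat) (U : set 'rV[R]_d)
    (A B : 'rV[R]_d -> 'rV[R[i]]_d) : Prop :=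
  forall g : 'rV[R]_d -> R[i], smooth_on U g -> forall u, U u ->
    vfield_act A (vfield_act B g) u = vfield_act B (vfield_act A g) u.

Definition mdeg (m : nat) (alpha : 'I_m -> nat) : nat := (\sum_(j < m) alpha j)%N.

(* X^alpha = X_1^alpha_1 o ... o X_m^alpha_m; the last field acts first. *)
Definition vfield_pow (R : realType) (d m : nat)
    (X : 'I_m -> 'rV[R]_d -> 'rV[R[i]]_d) (alpha : 'I_m -> nat)
    (g : 'rV[R]_d -> R[i]) : 'rV[R]_d -> R[i] :=
  foldr (fun j h => iter (alpha j) (vfield_act (X j)) h) g (enum 'I_m).

(* The modulus of a complex number as an element of R. *)
Definition cmod (R : realType) (z : R[i]) : R := ComplexField.Normc.normc z.

Definition CM_space (R : realType) (M : nat -> R) (d m : nat)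
    (U : set 'rV[R]_d) (X : 'I_m -> 'rV[R]_d -> 'rV[R[i]]_d)
    (f : 'rV[R]_d -> R[i]) : Prop :=
  smooth_on U f /\
  forall K : set 'rV[R]_d, compact K -> K `<=` U ->
    exists C : R, 0 < C /\
      forall (alpha : 'I_m -> nat) (u : 'rV[R]_d), K u ->
        cmod (vfield_pow X alpha f u) <= C ^+ (mdeg alpha).+1 * M (mdeg alpha).

Definition compactly_contained (R : realType) (d : nat)
    (V U : set 'rV[R]_d) : Prop :=
  compact (closure V) /\ closure V `<=` U.

(* The library norm on row vectors is the sup norm; this is the Euclidean one. *)
Definition enorm (R : realType) (m : nat) (v : 'rV[R]_m) : R :=
  Num.sqrt (\sum_(j < m) v 0 j ^+ 2).

(* L_j = d/dv_j - X_j, with X_j acting in the variable u. *)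
Definition Lfield (R : realType) (d m : nat)
    (X : 'I_m -> 'rV[R]_d -> 'rV[R[i]]_d) (j : 'I_m)
    (F : 'rV[R]_d * 'rV[R]_m -> R[i]) (u : 'rV[R]_d) (v : 'rV[R]_m) : R[i] :=
  cderive (delta_mx 0 j) (fun v' => F (u, v')) v
  - vfield_act (X j) (fun u' => F (u', v)) u.

(* [F] is in C(V x R^m) and C^infty(V x (R^m \ {0})), restricts to [f] on
   v = 0, and satisfies the estimates on L_j F. *)
Definition asymptotic_extension (R : realType) (M : nat -> R) (d m : nat)
    (X : 'I_m -> 'rV[R]_d -> 'rV[R[i]]_d) (V : set 'rV[R]_d)
    (f : 'rV[R]_d -> R[i]) (delta Q : R)
    (F : 'rV[R]_d * 'rV[R]_m -> R[i]) : Prop :=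
  [/\ ccontinuous_on (V `*` [set: 'rV[R]_m]) F,
      smooth_on (V `*` [set v : 'rV[R]_m | v != 0]) F,
      forall u, V u -> F (u, 0) = f u
    & forall (u : 'rV[R]_d) (v : 'rV[R]_m) (k : nat) (j : 'I_m),
        V u -> 0 < enorm v -> enorm v < delta ->
        cmod (Lfield X j F u v) <= Q ^+ k.+1 * wquot M k * enorm v ^+ k].

(* For every u in V, the function v |-> X^gamma F(u, v) is C^infty on R^m. *)
Definition smooth_in_v (R : realType) (d m : nat)
    (X : 'I_m -> 'rV[R]_d -> 'rV[R[i]]_d) (V : set 'rV[R]_d)
    (F : 'rV[R]_d * 'rV[R]_m -> R[i]) (gamma : 'I_m -> nat) : Prop :=
  forall u, V u ->
    smooth_on [set: 'rV[R]_m]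
      (fun v => vfield_pow X gamma (fun u' => F (u', v)) u).

(* Main.v *)
Require Import Defs.
From mathcomp Require Import all_boot all_order all_algebra.
From mathcomp Require Import complex.
From mathcomp Require Import all_classical all_reals all_analysis.
From mathcomp Require Import ring lra.
Import Order.TTheory GRing.Theory Num.Theory.
Import numFieldNormedType.Exports.
Local Open Scope classical_set_scope.
Local Open Scope ring_scope.

(** Put m_k = M_k / k!, r_k = m_k / m_{k+1} (a sequence decreasing to 0) and let
    chi be a bump function equal to 1 on |v| <= 1/2 and to 0 on |v| >= 1. The
    extension is a Borel-type sum
      F(u, v) = sum_k chi(lam v / r_k) P_k(u, v),   P_k = (v . X)^k f / k!,
    where lam is large; it is locally finite off v = 0. As the fields commute,
    d/dv_j P_{k+1} = X_j P_k, so that L_j F telescopes into terms that live where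
    lam |v| is comparable with r_k; there the k-th term is bounded by
    2^-k m_l (2 lam |v|)^l for every l, by log-convexity, and the derivative
    costs one factor 1/|v|, absorbed by m_{l+1} <= A^l m_l. Smoothness of F and
    of X^gamma F in v at v = 0 follows because the terms of order k > n + 1 have
    derivatives of order at most n that are O(2^-k |v|^2); this needs lam to beat
    the growth of M_{k+g} / M_k, which is geometric in k for bounded g by the
    third regularity condition, and uniformly in g under moderate growth. *)

Set Implicit Arguments.
Unset Strict Implicit.
Unset Printing Implicit Defensive.

(** * Functions with iterated directional derivatives *)

(** The hypothesis on f controls derivatives along the fields X only, so the u-derivatives of the
    series in other directions have no bound near v = 0. Hence three separate arguments: joint
    smoothness off v = 0 by local finiteness, continuity at v = 0 by a tail bound uniform in u, and
    smoothness in v at fixed u, where F is a series of cut-off monomials with numerical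
    coefficients. Origin of the radius r_k: consecutive terms of m_k y^k have quotient y / r_k, so
    this sequence in k is smallest where r_k <= y <= r_{k-1}. An error of order k that lives only at
    lam |v| near r_k is thus comparable with the infimum over all l, and one F serves every exponent
    of the estimate. Origin of lam: C m pays for the factor C^k in the bounds on f and for the m^k
    words of length k. Of the remaining 4 = 2 * 2, one 2^-k absorbs factors polynomial in k, the
    other makes the sum converge. A last factor pays for X^gamma: 2 A^kappa with A from the third
    regularity condition, or H from moderate growth, which does not depend on gamma. *)

Fixpoint Cn {R : realType} {E : normedModType R} (n : nat) (W : set E)
    (g : E -> R) : Prop :=
  [/\ forall x, W x -> {for x, continuous g},
      forall x w, W x -> derivable g x w
    & if n is n'.+1 then forall w, Cn n' W (fun x => 'D_w g x) else True].

Section Cn_theory.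
Variables (R : realType) (E : normedModType R).
Implicit Types (W : set E) (g h : E -> R) (n : nat).

Lemma Cn_cont n W g x : Cn n W g -> W x -> {for x, continuous g}.
Proof. by case: n => [|n] [c _ _] Wx; apply: c. Qed.

Lemma Cn_derivable n W g x w : Cn n W g -> W x -> derivable g x w.
Proof. by case: n => [|n] [_ d _] Wx; apply: d. Qed.

Lemma Cn_derive n W g w : Cn n.+1 W g -> Cn n W (fun x => 'D_w g x).
Proof. by case=> _ _ s; apply: s. Qed.

Lemma CnS n W g : (forall x, W x -> {for x, continuous g}) ->
  (forall x w, W x -> derivable g x w) ->
  (forall w, Cn n W (fun x => 'D_w g x)) -> Cn n.+1 W g.
Proof. by []. Qed.

Lemma Cn0 W g : (forall x, W x -> {for x, continuous g}) ->
  (forall x w, W x -> derivable g x w) -> Cn 0 W g.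
Proof. by []. Qed.

Lemma CnW n W g : Cn n.+1 W g -> Cn n W g.
Proof.
elim: n g => [|n IH] g [c d s]; first exact: Cn0.
by apply: CnS => // w; apply: IH; apply: s.
Qed.

Lemma Cn_sub n W W' g : W' `<=` W -> Cn n W g -> Cn n W' g.
Proof.
elim: n g => [|n IH] g sub [c d s].
  by apply: Cn0 => [x /sub|x w /sub]; [apply: c|apply: d].
apply: CnS => [x /sub|x w /sub|w]; [apply: c|apply: d|].
by apply: IH => //; apply: s.
Qed.

(** The clauses of [Cn] concern germs at the points of the set, and ['D_w g] is a total function
    chosen independently of the set; so [B] may vary with the point. *)
Lemma Cn_local n W g :
  (forall x, W x -> exists B : set E, B x /\ Cn n B g) -> Cn n W g.
Proof.
elim: n g => [|n IH] g loc.
  by apply: Cn0 => [x|x w] /loc[B [Bx [c d _]]]; [apply: c|apply: d].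
apply: CnS => [x /loc[B [Bx [c _ _]]]|x w /loc[B [Bx [_ d _]]]|w].
- by apply: c.
- by apply: d.
- by apply: IH => x /loc[B [Bx [_ _ s']]]; exists B; split=> //; apply: s'.
Qed.

Lemma open_near_eq (T : Type) W (g h : E -> T) x : open W ->
  {in W, g =1 h} -> W x ->
  \forall y \near x, g y = h y.
Proof.
move=> oW gh Wx; have := open_nbhs_nbhs (conj oW Wx).
by apply: filterS => y Wy; apply: gh; rewrite inE.
Qed.

Lemma Cn_eq n W g h : open W -> {in W, g =1 h} -> Cn n W g -> Cn n W h.
Proof.
elim: n g h => [|n IH] g h oW gh gn.
all: have c x : W x -> {for x, continuous h} by
  move=> Wx; rewrite /prop_for /continuous_at -gh ?inE//;
  apply: cvg_trans (Cn_cont gn Wx); apply: near_eq_cvg; exact: open_near_eq Wx.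
all: have d x w : W x -> derivable h x w by
  move=> Wx; apply: (near_eq_derivable (open_near_eq oW gh Wx));
  exact: Cn_derivable gn Wx.
  exact: Cn0.
apply: CnS => // w; apply: (IH (fun x => 'D_w g x)) => //; last exact: Cn_derive.
move=> x /set_mem Wx; by apply: near_eq_derive; exact: open_near_eq Wx.
Qed.

Lemma Cn_cst n W (a : R) : Cn n W (fun _ : E => a).
Proof.
elim: n a => [|n IH] a.
all: have c (x : E) : W x -> {for x, continuous (fun _ : E => a)} by
  move=> _; exact: cvg_cst.
all: have d (x w : E) : W x -> derivable (fun _ : E => a) x w by
  move=> _; exact: derivable_cst.
  exact: Cn0.
apply: CnS => // w.
suff -> : (fun x => 'D_w (fun _ : E => a) x) = (fun _ => 0) by exact: IH.
by apply/funext => x; exact: derive_cst.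
Qed.

Lemma derive_add g h x w : derivable g x w -> derivable h x w ->
  derivable (fun y => g y + h y) x w /\
  'D_w (fun y => g y + h y) x = 'D_w g x + 'D_w h x.
Proof. by move=> dg dh; split; [exact: (derivableD dg dh)|exact: (deriveD dg dh)]. Qed.

Lemma derive_mul g h x w : derivable g x w -> derivable h x w ->
  derivable (fun y => g y * h y) x w /\
  'D_w (fun y => g y * h y) x = g x * 'D_w h x + h x * 'D_w g x.
Proof. by move=> dg dh; split; [exact: (derivableM dg dh)|exact: (deriveM dg dh)]. Qed.

Lemma derive_scalel g (c : R) x w : derivable g x w ->
  derivable (fun y => c * g y) x w /\ 'D_w (fun y => c * g y) x = c * 'D_w g x.
Proof.
move=> dg; have [d D] := derive_mul (derivable_cst c x w) dg.
by split; [exact: d|rewrite [LHS]D derive_cst mulr0 addr0].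
Qed.

Lemma derive_lincomb (I : Type) (r : seq I) (c : I -> R) (G : I -> E -> R)
    (x h : E) : (forall i, derivable (G i) x h) ->
  derivable (fun y => \sum_(i <- r) c i * G i y) x h /\
  'D_h (fun y => \sum_(i <- r) c i * G i y) x = \sum_(i <- r) c i * 'D_h (G i) x.
Proof.
move=> dG; elim: r => [|i r [d1 D1]].
  have -> : (fun y => \sum_(i <- [::]) c i * G i y) = cst 0.
    by apply/funext => y; rewrite big_nil.
  by split; [exact: derivable_cst|rewrite derive_cst big_nil].
have -> : (fun y => \sum_(j <- i :: r) c j * G j y) =
    (fun y => c i * G i y + \sum_(j <- r) c j * G j y).
  by apply/funext => y; rewrite big_cons.
have [d2 D2] := derive_scalel (c i) (dG i).
by have [d3 ->] := derive_add d2 d1; rewrite D2 D1 big_cons.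
Qed.

Lemma CnD n W g h : open W -> Cn n W g -> Cn n W h ->
  Cn n W (fun x => g x + h x).
Proof.
move=> oW; elim: n g h => [|n IH] g h gn hn.
all: have c (x : E) : W x -> {for x, continuous (fun x => g x + h x)} by
  move=> Wx; apply: cvgD; [exact: Cn_cont gn Wx|exact: Cn_cont hn Wx].
all: have d (x w : E) : W x -> derivable (fun x => g x + h x) x w by
  move=> Wx; apply: derivableD; [exact: Cn_derivable gn Wx|exact: Cn_derivable hn Wx].
  exact: Cn0.
apply: CnS => // w.
apply: (Cn_eq _ _ (IH _ _ (Cn_derive w gn) (Cn_derive w hn))) => // x /set_mem Wx.
by apply/esym/deriveD; [exact: Cn_derivable gn Wx|exact: Cn_derivable hn Wx].
Qed.

Lemma CnM n W g h : open W -> Cn n W g -> Cn n W h ->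
  Cn n W (fun x => g x * h x).
Proof.
move=> oW; elim: n g h => [|n IH] g h gn hn.
all: have c (x : E) : W x -> {for x, continuous (fun x => g x * h x)} by
  move=> Wx; apply: cvgM; [exact: Cn_cont gn Wx|exact: Cn_cont hn Wx].
all: have d (x w : E) : W x -> derivable (fun x => g x * h x) x w by
  move=> Wx; apply: derivableM; [exact: Cn_derivable gn Wx|exact: Cn_derivable hn Wx].
  exact: Cn0.
apply: CnS => // w.
apply: (Cn_eq _ _ (CnD oW (IH _ _ (CnW gn) (Cn_derive w hn))
  (IH _ _ (CnW hn) (Cn_derive w gn)))) => // x /set_mem Wx.
by apply/esym/deriveM; [exact: Cn_derivable gn Wx|exact: Cn_derivable hn Wx].
Qed.

Lemma CnZ n W (a : R) g : open W -> Cn n W g -> Cn n W (fun x => a * g x).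
Proof. by move=> oW gn; apply: CnM => //; exact: Cn_cst. Qed.

Lemma CnN n W g : open W -> Cn n W g -> Cn n W (fun x => - g x).
Proof.
move=> oW /(CnZ (-1) oW); apply: Cn_eq => // x _; by rewrite mulN1r.
Qed.

Lemma CnB n W g h : open W -> Cn n W g -> Cn n W h ->
  Cn n W (fun x => g x - h x).
Proof. by move=> oW gn hn; apply: CnD => //; exact: CnN. Qed.

Lemma Cn_sum n W (I : Type) (s : seq I) (G : I -> E -> R) : open W ->
  (forall i, Cn n W (G i)) -> Cn n W (fun x => \sum_(i <- s) G i x).
Proof.
move=> oW Gn; elim: s => [|i s IH].
  by apply: (Cn_eq _ _ (Cn_cst n W 0)) => // x _; rewrite big_nil.
by apply: (Cn_eq _ _ (CnD oW (Gn i) IH)) => // x _; rewrite big_cons.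
Qed.

Lemma CnV n W g : open W -> (forall x, W x -> g x != 0) -> Cn n W g ->
  Cn n W (fun x => (g x)^-1).
Proof.
move=> oW g0; elim: n => [|n IH] gn.
all: have c (x : E) : W x -> {for x, continuous (fun x => (g x)^-1)} by
  move=> Wx; apply: cvgV; [exact: g0|exact: Cn_cont gn Wx].
all: have d (x w : E) : W x -> derivable (fun x => (g x)^-1) x w by
  move=> Wx; apply: derivableV; [exact: g0|exact: Cn_derivable gn Wx].
  exact: Cn0.
have /IH gin := CnW gn.
apply: CnS => // w.
apply: (Cn_eq _ _ (CnN oW (CnM oW (CnM oW gin gin) (Cn_derive w gn)))) => // x /set_mem Wx.
rewrite deriveV//; [|exact: g0|exact: Cn_derivable gn Wx].
by rewrite expr2 invfM scaleNr.
Qed.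

(** Chain rule for a [g] with only a directional derivative: restricted to the line x + t w, both
    functions live on [R], where derivable and differentiable agree. *)
Lemma derivable_derive_comp (phi : R -> R) g x w :
  derivable g x w -> derivable phi (g x) 1 ->
  derivable (phi \o g) x w /\ 'D_w (phi \o g) x = 'D_1 phi (g x) * 'D_w g x.
Proof.
move=> /derivable1P dg dphi.
have e (G : E -> R) :
    'D_w G x = 'D_1 (fun h : R => G (h *: w + x)) 0.
  rewrite /derive; set g1 := fun t : R => t^-1 *: _; set g2 := fun t : R => t^-1 *: _.
  suff -> : g1 = g2 by [].
  by apply/funext => t; rewrite /g1 /g2 /= addr0 scale0r add0r [_%:A]mulr1.
have g0 : g (0 *: w + x) = g x by rewrite scale0r add0r.
split.
  have h1 : differentiable (fun h : R => g (h *: w + x)) 0 := (derivable1_diffP _ _).1 dg.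
  apply: (derivable1P _ _ _).2; apply: (derivable1_diffP _ _).2.
  apply: (differentiable_comp h1); rewrite g0; exact: (derivable1_diffP _ _).1 dphi.
have dphi' : derivable phi (g (0 *: w + x)) 1 by rewrite g0.
have := derive1_comp dg dphi'.
by rewrite !derive1E (e (phi \o g)) (e g) g0.
Qed.

End Cn_theory.

Lemma Cn_comp (R : realType) (E : normedModType R) n (W : set E)
    (phi : R -> R) (g : E -> R) : open W ->
  Cn n [set: R] phi -> Cn n W g -> Cn n W (fun x => phi (g x)).
Proof.
move=> oW; elim: n phi g => [|n IH] phi g pn gn.
all: have c (x : E) : W x -> {for x, continuous (phi \o g)} by
  move=> Wx; apply: continuous_comp; [exact: Cn_cont gn Wx|exact: Cn_cont pn I].
all: have d (x w : E) : W x -> derivable (phi \o g) x w by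
  move=> Wx; apply: (derivable_derive_comp _ _).1;
  [exact: Cn_derivable gn Wx|exact: Cn_derivable pn I].
  exact: Cn0.
apply: CnS => // w.
have p' : Cn n [set: R] (fun y => 'D_1 phi y) := Cn_derive (1 : R) pn.
apply: (Cn_eq _ _ (CnM oW (IH _ _ p' (CnW gn)) (Cn_derive w gn))) => // x /set_mem Wx.
rewrite (derivable_derive_comp (Cn_derivable gn Wx) (Cn_derivable pn I)).2.
by [].
Qed.

(** The difference quotient of g o T along w is literally that of g along T w, so no chain rule is
    involved. This serves projections and dilations. *)
Lemma Cn_comp_linear (R : realType) (E E' : normedModType R) n (W : set E)
    (T : {linear E' -> E}) (g : E -> R) : continuous T ->
  Cn n W g -> Cn n (T @^-1` W) (g \o T) /\
  forall x w, 'D_w (g \o T) x = 'D_(T w) g (T x).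
Proof.
move=> cT.
have e (h : E -> R) (x w : E') :
    (fun t => t^-1 *: (((h \o T) \o shift x) (t *: w) - (h \o T) x))
  = (fun t => t^-1 *: ((h \o shift (T x)) (t *: T w) - h (T x))).
  by apply/funext => t /=; rewrite linearP.
have De (h : E -> R) (x w : E') : 'D_w (h \o T) x = 'D_(T w) h (T x) by rewrite /derive -(e h).
split=> //; elim: n g H => [|n IH] g gn.
all: have c (x : E') : (T @^-1` W) x -> {for x, continuous (g \o T)} by
  move=> Wx; apply: continuous_comp; [exact: cT|exact: Cn_cont gn Wx].
all: have d (x w : E') : (T @^-1` W) x -> derivable (g \o T) x w by
  move=> Wx; rewrite /derivable (e g); exact: Cn_derivable gn Wx.
  exact: Cn0.
apply: CnS => // w.
have -> : (fun x => 'D_w (g \o T) x) = (fun y => 'D_(T w) g y) \o T.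
  by apply/funext => x; rewrite De.
by apply: IH; exact: Cn_derive gn.
Qed.

Section complex_parts.
Variable R : realType.
Implicit Types a b : R[i].

Lemma cReD a b : complex.Re (a + b) = complex.Re a + complex.Re b.
Proof. by case: a; case: b. Qed.

Lemma cImD a b : complex.Im (a + b) = complex.Im a + complex.Im b.
Proof. by case: a; case: b. Qed.

Lemma cReM a b : complex.Re (a * b) =
  complex.Re a * complex.Re b - complex.Im a * complex.Im b.
Proof. by case: a; case: b. Qed.

Lemma cImM a b : complex.Im (a * b) =
  complex.Re a * complex.Im b + complex.Im a * complex.Re b.
Proof. by case: a; case: b. Qed.

Lemma cRe_realM (r : R) a : complex.Re (r%:C%C * a) = r * complex.Re a.
Proof. by rewrite cReM mul0r subr0. Qed.

Lemma cIm_realM (r : R) a : complex.Im (r%:C%C * a) = r * complex.Im a.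
Proof. by rewrite cImM mul0r addr0. Qed.

Lemma cRe_realsum (I : Type) (s : seq I) (c : I -> R) (z : I -> R[i]) :
  complex.Re (\sum_(i <- s) (c i)%:C%C * z i) = \sum_(i <- s) c i * complex.Re (z i).
Proof.
elim: s => [|i s IH]; first by rewrite !big_nil.
by rewrite !big_cons cReD cRe_realM IH.
Qed.

Lemma cIm_realsum (I : Type) (s : seq I) (c : I -> R) (z : I -> R[i]) :
  complex.Im (\sum_(i <- s) (c i)%:C%C * z i) = \sum_(i <- s) c i * complex.Im (z i).
Proof.
elim: s => [|i s IH]; first by rewrite !big_nil.
by rewrite !big_cons cImD cIm_realM IH.
Qed.

Lemma complex_ext a b : complex.Re a = complex.Re b ->
  complex.Im a = complex.Im b -> a = b.
Proof. by case: a => ? ?; case: b => ? ? /= -> ->. Qed.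

End complex_parts.

(** * Smoothness of complex functions through their real and imaginary parts *)

Section smooth_on_theory.
Variables (R : realType) (E : normedModType R).
Implicit Types (W : set E) (g h : E -> R[i]).

Definition rderives (s : seq E) (g : E -> R) : E -> R :=
  foldr (fun w (G : E -> R) x => 'D_w G x) g s.

Lemma rderives_rcons s w (g : E -> R) :
  rderives (rcons s w) g = rderives s (fun x => 'D_w g x).
Proof. by rewrite /rderives foldr_rcons. Qed.

Lemma Re_cderives s g :
  (fun x => complex.Re (cderives s g x)) = rderives s (fun x => complex.Re (g x)).
Proof. by elim: s => //= w s <-. Qed.

Lemma Im_cderives s g :
  (fun x => complex.Im (cderives s g x)) = rderives s (fun x => complex.Im (g x)).
Proof. by elim: s => //= w s <-. Qed.

Lemma Cn_rderives n W (g : E -> R) s :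
  Cn (size s + n) W g -> Cn n W (rderives s g).
Proof.
elim/last_ind: s g => [|s w IH] g //; rewrite size_rcons rderives_rcons => gn.
by apply: IH; exact: Cn_derive gn.
Qed.

(** [Cn] peels off the derivative taken first, which is the last entry of the list; hence [rcons]
    here and in [Cn_rderives]. Together they identify [smooth_on], which quantifies over lists, with
    [Cn] at all orders. *)
Lemma rderives_Cn n W (g : E -> R) :
  (forall s, (size s <= n)%N ->
    (forall x, W x -> {for x, continuous (rderives s g)}) /\
    (forall x w, W x -> derivable (rderives s g) x w)) ->
  Cn n W g.
Proof.
elim: n g => [|n IH] g H.
  by have [c d] := H [::] isT; exact: Cn0.
have [c d] := H [::] isT; apply: CnS => // w; apply: IH => s sn.
by rewrite -rderives_rcons; apply: H; rewrite size_rcons.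
Qed.

Lemma smooth_onP W g : smooth_on W g <->
  (forall n, Cn n W (fun x => complex.Re (g x))) /\
  (forall n, Cn n W (fun x => complex.Im (g x))).
Proof.
split=> [H|[HRe HIm] s].
  split=> n; apply: rderives_Cn => s _; have [c d] := H s.
    by rewrite -Re_cderives; split=> [x /c[]|x w /(d x w)[]].
  by rewrite -Im_cderives; split=> [x /c[]|x w /(d x w)[]].
have HR := Cn_rderives (HRe (size s + 0)%N).
have HI := Cn_rderives (HIm (size s + 0)%N).
split=> [x Wx|x w Wx].
  by split; rewrite ?Re_cderives ?Im_cderives; [exact: Cn_cont HR Wx|exact: Cn_cont HI Wx].
by split; rewrite ?Re_cderives ?Im_cderives;
  [exact: Cn_derivable HR Wx|exact: Cn_derivable HI Wx].
Qed.

Lemma smooth_on_eq W g h : open W -> {in W, g =1 h} ->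
  smooth_on W g -> smooth_on W h.
Proof.
move=> oW gh /smooth_onP[gR gI]; apply/smooth_onP.
by split=> n; [apply: (Cn_eq oW _ (gR n))|apply: (Cn_eq oW _ (gI n))] => x Wx /=;
  rewrite gh.
Qed.

Lemma smooth_on_sub W W' g : W' `<=` W -> smooth_on W g -> smooth_on W' g.
Proof.
by move=> sub /smooth_onP[gR gI]; apply/smooth_onP; split=> n; apply: Cn_sub sub _.
Qed.

Lemma smooth_on_cderive W g w : smooth_on W g -> smooth_on W (cderive w g).
Proof.
move=> /smooth_onP[gR gI]; apply/smooth_onP.
by split=> n; [exact: Cn_derive (gR n.+1)|exact: Cn_derive (gI n.+1)].
Qed.

Lemma smooth_on_cderivable W g x w : smooth_on W g -> W x -> cderivable g x w.
Proof. by move=> /(_ [::])[_ d] Wx; exact: d. Qed.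

Lemma smooth_onD W g h : open W -> smooth_on W g -> smooth_on W h ->
  smooth_on W (fun x => g x + h x).
Proof.
move=> oW /smooth_onP[gR gI] /smooth_onP[hR hI]; apply/smooth_onP; split=> n.
  by apply: (Cn_eq oW _ (CnD oW (gR n) (hR n))) => x _; rewrite ?cReD ?cImD.
by apply: (Cn_eq oW _ (CnD oW (gI n) (hI n))) => x _; rewrite ?cReD ?cImD.
Qed.

Lemma smooth_onM W g h : open W -> smooth_on W g -> smooth_on W h ->
  smooth_on W (fun x => g x * h x).
Proof.
move=> oW /smooth_onP[gR gI] /smooth_onP[hR hI]; apply/smooth_onP; split=> n.
  apply: (Cn_eq oW _ (CnB oW (CnM oW (gR n) (hR n)) (CnM oW (gI n) (hI n)))) => x _.
  by rewrite cReM.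
apply: (Cn_eq oW _ (CnD oW (CnM oW (gR n) (hI n)) (CnM oW (gI n) (hR n)))) => x _.
by rewrite cImM.
Qed.

Lemma smooth_on_real W (b : E -> R) :
  (forall n, Cn n W b) -> smooth_on W (fun x => (b x)%:C%C).
Proof. by move=> bn; apply/smooth_onP; split=> n //=; exact: Cn_cst. Qed.

Lemma smooth_on_sum W (I : Type) (s : seq I) (G : I -> E -> R[i]) : open W ->
  (forall i, smooth_on W (G i)) -> smooth_on W (fun x => \sum_(i <- s) G i x).
Proof.
move=> oW Gn; elim: s => [|i s IH].
  apply: (smooth_on_eq oW _ (smooth_on_real (fun n => Cn_cst n W 0))) => x _.
  by rewrite big_nil.
by apply: (smooth_on_eq oW _ (smooth_onD oW (Gn i) IH)) => x _; rewrite big_cons.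
Qed.

Lemma near_cderive g h x w : (\forall y \near x, g y = h y) ->
  cderive w g x = cderive w h x.
Proof.
move=> gh; rewrite /cderive; congr Complex; apply: near_eq_derive;
  by apply: filterS gh => y ->.
Qed.

Lemma cderive_lincomb (I : Type) (r : seq I) (c : I -> R) (g : I -> E -> R[i]) x w :
  (forall i, cderivable (g i) x w) ->
  cderive w (fun y => \sum_(i <- r) (c i)%:C%C * g i y) x =
  \sum_(i <- r) (c i)%:C%C * cderive w (g i) x.
Proof.
move=> dg; rewrite /cderive.
have -> : (fun y => complex.Re (\sum_(i <- r) (c i)%:C%C * g i y)) =
    (fun y => \sum_(i <- r) c i * complex.Re (g i y)).
  by apply/funext => y; exact: cRe_realsum.
have -> : (fun y => complex.Im (\sum_(i <- r) (c i)%:C%C * g i y)) =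
    (fun y => \sum_(i <- r) c i * complex.Im (g i y)).
  by apply/funext => y; exact: cIm_realsum.
rewrite (derive_lincomb r c (fun i => (dg i).1)).2.
rewrite (derive_lincomb r c (fun i => (dg i).2)).2.
by apply: complex_ext; rewrite ?cRe_realsum ?cIm_realsum.
Qed.

(** Counterpart of [cderive_lincomb] for the variable v: the real cut-off monomials vary and the
    complex numbers X_w f(u) are frozen, whereas in u it is the other way round. *)
Lemma cderive_real_comb (I : Type) (r : seq I) (b : I -> E -> R) (a : I -> R[i])
    x w : (forall i, derivable (b i) x w) ->
  cderive w (fun y => \sum_(i <- r) (b i y)%:C%C * a i) x =
  \sum_(i <- r) ('D_w (b i) x)%:C%C * a i.
Proof.
move=> db; rewrite /cderive.
have -> : (fun y => complex.Re (\sum_(i <- r) (b i y)%:C%C * a i)) =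
    (fun y => \sum_(i <- r) complex.Re (a i) * b i y).
  by apply/funext => y; rewrite cRe_realsum; apply: eq_bigr => i _; exact: mulrC.
have -> : (fun y => complex.Im (\sum_(i <- r) (b i y)%:C%C * a i)) =
    (fun y => \sum_(i <- r) complex.Im (a i) * b i y).
  by apply/funext => y; rewrite cIm_realsum; apply: eq_bigr => i _; exact: mulrC.
rewrite (derive_lincomb r (fun i => complex.Re (a i)) db).2.
rewrite (derive_lincomb r (fun i => complex.Im (a i)) db).2.
by apply: complex_ext; rewrite ?cRe_realsum ?cIm_realsum;
  apply: eq_bigr => i _; exact: mulrC.
Qed.

End smooth_on_theory.

(** * Vector fields and their compositions *)

Section vector_fields.
Variables (R : realType) (d : nat).
Implicit Types (U V : set 'rV[R]_d) (A : 'rV[R]_d -> 'rV[R[i]]_d)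
  (g h : 'rV[R]_d -> R[i]).

Lemma near_vfield_act A g h u : (\forall y \near u, g y = h y) ->
  vfield_act A g u = vfield_act A h u.
Proof.
by move=> gh; apply: eq_bigr => i _; rewrite (near_cderive _ gh).
Qed.

Lemma vfield_act_eq U A g h : open U -> {in U, g =1 h} ->
  {in U, vfield_act A g =1 vfield_act A h}.
Proof.
by move=> oU gh u /set_mem Uu; apply/near_vfield_act/(open_near_eq oU gh Uu).
Qed.

Lemma smooth_vfield_act U A g : open U -> smooth_vfield U A ->
  smooth_on U g -> smooth_on U (vfield_act A g).
Proof.
move=> oU sA sg; apply: (smooth_on_sum _ oU) => i.
exact: (smooth_onM oU (sA i) (smooth_on_cderive _ sg)).
Qed.

Lemma vfield_act_sum V A (I : Type) (s : seq I) (c : I -> R)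
    (g : I -> 'rV[R]_d -> R[i]) u : V u -> (forall i, smooth_on V (g i)) ->
  vfield_act A (fun y => \sum_(i <- s) (c i)%:C%C * g i y) u =
  \sum_(i <- s) (c i)%:C%C * vfield_act A (g i) u.
Proof.
move=> Vu sg.
have H w := cderive_lincomb s c (fun i => smooth_on_cderivable w (sg i) Vu).
rewrite /vfield_act; under eq_bigr do rewrite H mulr_sumr.
rewrite exchange_big /=; apply: eq_bigr => i _; rewrite mulr_sumr.
by apply: eq_bigr => j _; rewrite mulrCA.
Qed.

Variables (m : nat) (U : set 'rV[R]_d) (X : 'I_m -> 'rV[R]_d -> 'rV[R[i]]_d).

(* Words replace multi-indices: [(v . X)^k] expands over the [m^k] words of
   length [k]. *)
Definition vfield_word (s : seq 'I_m) (g : 'rV[R]_d -> R[i]) :=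
  foldr (fun j h => vfield_act (X j) h) g s.

Definition word_of (alpha : 'I_m -> nat) : seq 'I_m :=
  flatten [seq nseq (alpha j) j | j <- enum 'I_m].

Lemma vfield_word_cat s t g :
  vfield_word (s ++ t) g = vfield_word s (vfield_word t g).
Proof. exact: foldr_cat. Qed.

Lemma vfield_powE alpha g : vfield_pow X alpha g = vfield_word (word_of alpha) g.
Proof.
rewrite /vfield_pow /word_of; elim: (enum 'I_m) => //= j s ->.
by rewrite vfield_word_cat; elim: (alpha j) => //= k ->.
Qed.

Lemma size_word_of alpha : size (word_of alpha) = mdeg alpha.
Proof.
rewrite /word_of size_flatten /shape -map_comp sumnE big_map /mdeg enumT.
by apply: eq_bigr => j _ /=; rewrite size_nseq.
Qed.

Lemma perm_word_of s : perm_eq s (word_of (fun j => count_mem j s)).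
Proof.
apply/allP => j _ /=; rewrite /word_of count_flatten -map_comp sumnE big_map.
rewrite (bigD1_seq j) ?mem_enum ?enum_uniq//= count_nseq /= eqxx mul1n.
by rewrite big1 ?addn0// => i /negPf ij; rewrite count_nseq /= ij.
Qed.

Hypothesis oU : open U.
Hypothesis sX : forall j, smooth_vfield U (X j).

Lemma smooth_vfield_word s g : smooth_on U g -> smooth_on U (vfield_word s g).
Proof.
move=> sg; elim: s => [|j s IH]; first exact: sg.
exact: (smooth_vfield_act oU (@sX j) IH).
Qed.

Lemma vfield_word_sum V s (I : Type) (r : seq I) (c : I -> R)
    (g : I -> 'rV[R]_d -> R[i]) : open V -> V `<=` U ->
  (forall i, smooth_on U (g i)) ->
  {in V, vfield_word s (fun y => \sum_(i <- r) (c i)%:C%C * g i y) =1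
     fun u => \sum_(i <- r) (c i)%:C%C * vfield_word s (g i) u}.
Proof.
move=> oV VU sg; elim: s => //= j s IH u uV.
rewrite (vfield_act_eq _ oV IH uV) (vfield_act_sum _ _ _ (VU _ (set_mem uV)) (fun i => smooth_vfield_word s (sg i))).
by [].
Qed.

Hypothesis commX : forall i j, commuting_on U (X i) (X j).

(** The head letter of [s] occurs in [t] and is pulled to the front by commutation; the remaining
    letters are handled by induction. *)
Lemma perm_vfield_word s t g : smooth_on U g -> perm_eq s t ->
  {in U, vfield_word s g =1 vfield_word t g}.
Proof.
move=> sg; elim: s t => [|j s IH] t st.
  by move: st; rewrite perm_sym => /perm_nilP ->.
have jt : j \in t by rewrite -(perm_mem st) mem_head.
have move_front t1 h : smooth_on U h ->
    {in U, vfield_act (X j) (vfield_word t1 h) =1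
           vfield_word t1 (vfield_act (X j) h)}.
  move=> sh; elim: t1 => //= i t1 IH1 u uU.
  (* Commutation is available on smooth functions only, so the smoothness of the inner composition
     is carried along. *)
  rewrite commX; [|exact: smooth_vfield_word|exact: set_mem].
  exact: vfield_act_eq IH1 u uU.
case/splitPr: jt st => t1 t2 st u uU.
have {}st : perm_eq s (t1 ++ t2) by rewrite -(perm_cons j) (permPl st) perm_catC/= perm_cons perm_catC.
rewrite /= (vfield_act_eq _ oU (IH _ st) uU).
rewrite (vfield_word_cat t1 t2) (vfield_word_cat t1 (j :: t2)).
exact: (move_front t1 _ (smooth_vfield_word t2 sg) u uU).
Qed.

(** [CM_space] bounds ordered compositions only; sorting a word keeps its length, so the same bound
    holds for all words. *)
Lemma vfield_word_bound (M : nat -> R) f K : (forall k, 0 <= M k) -> CM_space M U X f ->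
  compact K -> K `<=` U -> exists C : R, 1 <= C /\
  forall s u, K u -> cmod (vfield_word s f u) <= C ^+ (size s).+1 * M (size s).
Proof.
move=> M0 [sf Hf] cK KU; have [C [C0 HC]] := Hf K cK KU.
exists (Num.max 1 C); split; first by rewrite le_max lexx.
move=> s u Ku; rewrite (perm_vfield_word sf (perm_word_of s)); last exact/mem_set/KU.
rewrite -vfield_powE; apply: le_trans (HC _ u Ku) _.
rewrite -size_word_of -(perm_size (perm_word_of s)).
by apply: ler_wpM2r => //; apply: lerXn2r; rewrite ?nnegrE ?le_max ?ler01 ?lexx ?orbT// ltW.
Qed.

End vector_fields.

(** * Cutoff functions and cut-off monomials *)

Section flat.
Variables (R : realType) (E : normedModType R).

(** The difference quotient at 0 along w is O(|t|). Quadratic flatness is the form in which the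
    vanishing of derivatives at v = 0 is propagated throughout. *)
Lemma flat_derivative (g : E -> R) (C : R) :
  (forall v, `|g v| <= C * `|v| ^+ 2) ->
  [/\ {for 0, continuous g}, forall w, derivable g 0 w &
      forall w, 'D_w g 0 = 0].
Proof.
move=> H.
have g0 : g 0 = 0.
  by apply/eqP; rewrite -normr_le0; apply: le_trans (H 0) _; rewrite normr0 expr2 !mulr0.
have H' v : `|g v| <= `|C| * `|v| ^+ 2.
  by apply: le_trans (H v) _; rewrite ler_wpM2r ?exprn_ge0// ler_norm.
have cv w : (fun t => t^-1 *: ((g \o shift 0) (t *: w) - g 0)) @ (0 : R)^' --> (0 : R).
  apply/cvgr0Pnorm_le => e e0; near=> t.
  rewrite /= g0 subr0 addr0 normrM normfV.
  have t0 : 0 < `|t| by rewrite normr_gt0; near: t; exact: nbhs_dnbhs_neq.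
  rewrite ler_pdivrMl//; apply: le_trans (H' _) _.
  rewrite normrZ exprMn mulrCA expr2 -[leLHS]mulrA ler_pM2l//.
  have : `|t| < e / (`|C| * `|w| ^+ 2 + 1).
    near: t; apply: dnbhs0_lt; rewrite divr_gt0// ltr_wpDl// mulr_ge0//.
  have p : 0 < `|C| * `|w| ^+ 2 + 1 by rewrite ltr_wpDl// mulr_ge0.
  rewrite ltr_pdivlMr// => h; apply: le_trans (ltW h).
  by rewrite ler_wpM2l// lerDl.
split.
- rewrite /prop_for /continuous_at g0; apply/cvgr0Pnorm_le => e e0; near=> v.
  apply: le_trans (H' v) _.
  have v1 : `|v| <= 1 by near: v; apply: nbhs0_le.
  have v2 : `|v| <= e / (`|C| + 1).
    by near: v; apply: nbhs0_le; rewrite divr_gt0// ltr_wpDl.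
  have p : 0 < `|C| + 1 by rewrite ltr_wpDl.
  move: v2; rewrite ler_pdivlMr// => h; apply: le_trans h.
  rewrite mulrC expr2 -mulrA ler_wpM2l//.
  by apply: le_trans (_ : 1 * (`|C| + 1) <= _); rewrite ?ler_pM// ?lerDl// mul1r.
- by move=> w; apply/cvg_ex; exists 0; exact: cv.
- by move=> w; apply: cvg_lim => //; exact: cv.
Unshelve. all: by end_near. Qed.

End flat.

(** * A smooth cutoff on the real line *)

Section real_line.
Variable R : realType.

Lemma derivable_dir (f : R -> R) x w : derivable f x 1 ->
  derivable f x w /\ 'D_w f x = w * 'D_1 f x.
Proof.
move=> /derivable1_diffP df; split; first exact: diff_derivable.
rewrite !deriveE// -[X in 'd _ _ X = _](mulr1 w).
by rewrite [LHS]linearZ.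
Qed.

Lemma Cn_id n : Cn n [set: R] (fun x : R => x).
Proof.
have c x : [set: R] x -> {for x, continuous (fun x : R => x)} by move=> _; exact: cvg_id.
have d (x w : R) : [set: R] x -> derivable (fun x : R => x) x w by move=> _; exact: derivable_id.
case: n => [|n]; first exact: Cn0.
apply: CnS => // w.
suff -> : (fun x : R => 'D_w (fun x : R => x) x) = (fun=> w) by exact: Cn_cst.
by apply/funext => x; exact: derive_id.
Qed.

(* The span of the functions [x^-n exp(-1/x)] is stable under differentiation. *)
Definition expinv (n : nat) (x : R) : R :=
  if 0 < x then x^-1 ^+ n * expR (- x^-1) else 0.

Lemma expinv_ge0 n x : 0 <= expinv n x.
Proof.
rewrite /expinv; case: ifP => // x0.
by rewrite mulr_ge0 ?expR_ge0// exprn_ge0// invr_ge0 ltW.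
Qed.

Lemma expinv0_gt0 x : 0 < x -> 0 < expinv 0 x.
Proof. by move=> x0; rewrite /expinv x0 expr0 mul1r expR_gt0. Qed.

Lemma expinv_eq0 n x : x <= 0 -> expinv n x = 0.
Proof. by rewrite /expinv ltNge => ->. Qed.

(** With y = 1/x, the term of order n + 2 in the exponential series gives y^(n+2) <= (n+2)! e^y,
    which rearranges to the claim. *)
Lemma expinv_flat n x : `|expinv n x| <= (n.+2)`!%:R * `|x| ^+ 2.
Proof.
rewrite ger0_norm ?expinv_ge0// /expinv; case: ifP => x0; last first.
  by rewrite mulr_ge0// exprn_ge0.
have y0 : 0 < x^-1 by rewrite invr_gt0.
have f0 : (0 : R) < (n.+2)`!%:R by rewrite ltr0n fact_gt0.
have h : x^-1 ^+ n.+2 / (n.+2)`!%:R <= expR x^-1.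
  by apply: le_trans (expR_ge1Dxn n.+1 (ltW y0)); rewrite lerDr.
rewrite expRN ler_pdivrMr ?expR_gt0// (gtr0_norm x0).
rewrite ler_pdivrMr// in h; apply: le_trans (_ : x ^+ 2 * (expR x^-1 * n.+2`!%:R) <= _).
  apply: le_trans (_ : x ^+ 2 * x^-1 ^+ n.+2 <= _).
    by rewrite -(addn2 n) exprD mulrCA -exprMn mulfV ?gt_eqF// expr1n mulr1.
  by rewrite ler_wpM2l// exprn_ge0// ltW.
by rewrite le_eqVlt; apply/predU1P; left; ring.
Qed.

Lemma expinv_derive n x : derivable (expinv n) x 1 /\
  'D_1 (expinv n) x = - n%:R * expinv n.+1 x + expinv n.+2 x.
Proof.
have [x0|x0|->] := ltrgtP x 0.
- have near0 : \forall y \near x, (cst 0 : R -> R) y = expinv n y.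
    near=> y; rewrite expinv_eq0//; apply/ltW; near: y; exact: lt_nbhsl.
  split; first by apply: (near_eq_derivable near0); exact: derivable_cst.
  rewrite -(near_eq_derive _ near0) derive_cst !expinv_eq0 ?ltW// mulr0 add0r//.
- pose G := (fun y : R => y^-1) ^+ n * (expR \o (fun y : R => - y^-1)).
  have nearG : \forall y \near x, G y = expinv n y.
    near=> y; rewrite /expinv ifT; last by near: y; exact: lt_nbhsr.
    by rewrite /G !fctE.
  have xn0 : x != 0 by rewrite gt_eqF.
  have di : is_derive x 1 (fun y : R => y^-1) (- x ^- 2 *: 1).
    have idd := @derivable_id _ _ x (1 : R).
    apply: DeriveDef; first exact: (derivableV (f := fun y => y)).
    by rewrite (deriveV (f := fun y => y))// derive_id.
  have dN : is_derive x 1 (fun y : R => - y^-1) (x ^- 2).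
    apply: is_derive_eq (is_deriveN di) _.
    by rewrite scaleNr opprK [LHS]mulr1.
  have [de De] := derivable_derive_comp (@ex_derive _ _ _ _ _ _ _ dN) (@derivable_expR _ (- x^-1)).
  have de' : is_derive x 1 (expR \o (fun y : R => - y^-1)) (expR (- x^-1) * x ^- 2).
    by apply: DeriveDef => //; rewrite De !derive_val.
  have dG := is_deriveM (is_deriveX n di) de'.
  split; first exact: (near_eq_derivable nearG (@ex_derive _ _ _ _ _ _ _ dG)).
  rewrite -(near_eq_derive _ nearG) [LHS](@derive_val _ _ _ _ _ _ _ dG) /expinv x0.
  rewrite /GRing.scale/= mulr1 {dG}.
  have -> : ((fun y : R => y^-1) ^+ n) x = x^-1 ^+ n by rewrite fctE.
  rewrite -exprVn; set y := x^-1; set e := expR _.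
  clear G nearG; case: n => [|n] /=; first by rewrite !mul0r oppr0 mul0r mulr0 addr0 add0r expr0 mul1r mulrC.
  by rewrite !exprS; ring.
(* At the junction x = 0 flatness supplies the derivative 0. *)
- have [_ dd D0] := flat_derivative (expinv_flat n).
  by split; [exact: dd|rewrite D0 !expinv_eq0// mulr0 addr0].
Unshelve. all: by end_near. Qed.

Lemma Cn_expinv k n : Cn k [set: R] (expinv n).
Proof.
elim: k n => [|k IH] n.
all: have c x : [set: R] x -> {for x, continuous (expinv n)} by
  move=> _; apply/differentiable_continuous/derivable1_diffP; exact: (expinv_derive n x).1.
all: have d x w : [set: R] x -> derivable (expinv n) x w by
  move=> _; exact: (derivable_dir _ (expinv_derive n x).1).1.
  exact: Cn0.
apply: CnS => // w.
have H := CnZ w openT (CnD openT (CnZ (- n%:R) openT (IH n.+1)) (IH n.+2)).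
apply: (Cn_eq openT _ H) => x _.
by rewrite (derivable_dir _ (expinv_derive n x).1).2 (expinv_derive n x).2.
Qed.

(** The thresholds 1/4 and 1 become the radii 1/2 and 1 once the argument is a squared norm. The
    denominator never vanishes because x < 1 or x > 1/4. *)
Definition cutoff (x : R) : R :=
  expinv 0 (1 - x) / (expinv 0 (1 - x) + expinv 0 (x - 4^-1)).

Lemma cutoff_den_gt0 x : 0 < expinv 0 (1 - x) + expinv 0 (x - 4^-1).
Proof.
have [x1|x1] := ltP x 1.
  by rewrite ltr_pwDl ?expinv_ge0// expinv0_gt0// subr_gt0.
rewrite ltr_wpDl ?expinv_ge0// expinv0_gt0//; lra.
Qed.

Lemma cutoff_eq1 x : x <= 4^-1 -> cutoff x = 1.
Proof.
move=> h; have := cutoff_den_gt0 x; rewrite /cutoff (@expinv_eq0 0 (x - 4^-1)); last lra.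
by rewrite addr0 => h0; rewrite mulfV// gt_eqF.
Qed.

Lemma cutoff_eq0 x : 1 <= x -> cutoff x = 0.
Proof. by move=> h; rewrite /cutoff expinv_eq0 ?mul0r//; lra. Qed.

Lemma cutoff_ge0 x : 0 <= cutoff x.
Proof. by rewrite divr_ge0 ?addr_ge0 ?expinv_ge0. Qed.

Lemma cutoff_le1 x : cutoff x <= 1.
Proof. by rewrite ler_pdivrMr ?cutoff_den_gt0// mul1r lerDl expinv_ge0. Qed.

Lemma Cn_cutoff n : Cn n [set: R] cutoff.
Proof.
have H1 : Cn n [set: R] (fun x => expinv 0 (1 - x)).
  by apply: Cn_comp openT (Cn_expinv n 0) _; apply: CnB openT (Cn_cst _ _ _) (Cn_id _).
have H2 : Cn n [set: R] (fun x => expinv 0 (x - 4^-1)).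
  by apply: Cn_comp openT (Cn_expinv n 0) _; apply: CnB openT (Cn_id _) (Cn_cst _ _ _).
apply: CnM openT H1 (CnV openT _ (CnD openT H1 H2)) => x _.
by rewrite gt_eqF// cutoff_den_gt0.
Qed.

End real_line.

(** * Euclidean norm, radial bump and monomials indexed by words *)

Section euclid.
Variables (R : realType) (m : nat).
Implicit Types (v x : 'rV[R]_m) (w : seq 'I_m).

Definition sqnorm v : R := \sum_(j < m) v 0 j ^+ 2.

Lemma sqnorm_ge0 v : 0 <= sqnorm v.
Proof. by apply: sumr_ge0 => j _; rewrite exprn_even_ge0. Qed.

Lemma enorm_ge0 v : 0 <= enorm v. Proof. exact: sqrtr_ge0. Qed.

Lemma sqr_enorm v : enorm v ^+ 2 = sqnorm v.
Proof. by rewrite sqr_sqrtr// sqnorm_ge0. Qed.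

Lemma enormZ c v : enorm (c *: v) = `|c| * enorm v.
Proof.
rewrite /enorm -sqrtr_sqr -sqrtrM ?exprn_even_ge0// mulr_sumr.
by congr Num.sqrt; apply: eq_bigr => j _; rewrite mxE exprMn.
Qed.

Lemma coord_le_norm v j : `|v 0 j| <= `|v|.
Proof.
rewrite [leRHS]mx_normrE; exact: (le_bigmax _ (fun ij => `|v ij.1 ij.2|) (0, j)).
Qed.

Lemma norm_le_enorm v : `|v| <= enorm v.
Proof.
rewrite [leLHS]mx_normrE; apply/bigmax_leP; split=> [|[i j] _ /=]; first exact: enorm_ge0.
rewrite (ord1 i) -sqrtr_sqr ler_wsqrtr// (bigD1 j)//= lerDl.
by apply: sumr_ge0 => k _; rewrite exprn_even_ge0.
Qed.

Lemma coord_le_enorm v j : `|v 0 j| <= enorm v.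
Proof. exact: le_trans (coord_le_norm v j) (norm_le_enorm v). Qed.

Lemma enorm0 : enorm (0 : 'rV[R]_m) = 0.
Proof. by rewrite -(scale0r (0 : 'rV[R]_m)) enormZ normr0 mul0r. Qed.

Lemma derivable_coord j v h : derivable (fun v : 'rV[R]_m => v 0 j) v h /\
  'D_h (fun v : 'rV[R]_m => v 0 j) v = h 0 j.
Proof.
have cv : (fun t : R => t^-1 *: (((fun v : 'rV[R]_m => v 0 j) \o shift v) (t *: h)
    - v 0 j)) @ (0 : R)^' --> h 0 j.
  have e : \forall t \near (0 : R)^', cst (h 0 j) t =
      t^-1 *: (((fun v : 'rV[R]_m => v 0 j) \o shift v) (t *: h) - v 0 j).
    near=> t; rewrite /= !mxE addrK /GRing.scale/= mulKf//.
    by near: t; exact: nbhs_dnbhs_neq.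
  exact: cvg_trans (near_eq_cvg e) (cvg_cst (h 0 j)).
split; first by apply/cvg_ex; exists (h 0 j).
exact: cvg_lim cv.
Unshelve. all: by end_near. Qed.

Lemma Cn_coord n j : Cn n [set: 'rV[R]_m] (fun v => v 0 j).
Proof.
have c (v : 'rV[R]_m) : [set: 'rV[R]_m] v -> {for v, continuous (fun v : 'rV[R]_m => v 0 j)}.
  by move=> _; exact: coord_continuous.
have d (v h : 'rV[R]_m) : [set: 'rV[R]_m] v -> derivable (fun v : 'rV[R]_m => v 0 j) v h.
  by move=> _; exact: (derivable_coord j v h).1.
case: n => [|n]; first exact: Cn0.
apply: CnS => // h; apply: (Cn_eq openT _ (Cn_cst n _ (h 0 j))) => v _.
by rewrite (derivable_coord j v h).2.
Qed.

Lemma Cn_sqnorm n : Cn n [set: 'rV[R]_m] sqnorm.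
Proof.
apply: Cn_sum openT _ => j.
by apply: (Cn_eq openT _ (CnM openT (Cn_coord n j) (Cn_coord n j))) => v _; rewrite expr2.
Qed.

(** The squared norm is a polynomial, hence smooth at 0 as well, unlike [enorm]. *)
Definition ebump v : R := cutoff (sqnorm v).

Lemma Cn_ebump n : Cn n [set: 'rV[R]_m] ebump.
Proof. exact: Cn_comp openT (Cn_cutoff R n) (Cn_sqnorm n). Qed.

Lemma ebump_eq1 v : enorm v <= 2^-1 -> ebump v = 1.
Proof.
move=> h; apply: cutoff_eq1; rewrite -sqr_enorm.
apply: le_trans (_ : 2^-1 ^+ 2 <= _); last by rewrite expr2; lra.
by apply: lerXn2r; rewrite ?nnegrE ?enorm_ge0//; lra.
Qed.

Lemma ebump_eq0 v : 1 <= enorm v -> ebump v = 0.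
Proof.
move=> h; apply: cutoff_eq0; rewrite -sqr_enorm.
by rewrite -(expr1n _ 2); apply: lerXn2r; rewrite ?nnegrE ?enorm_ge0//.
Qed.

Definition monom w v : R := \prod_(j <- w) v 0 j.

Lemma monom_cons j w v : monom (j :: w) v = v 0 j * monom w v.
Proof. exact: big_cons. Qed.

Lemma Cn_monom n w : Cn n [set: 'rV[R]_m] (monom w).
Proof.
elim: w => [|j w IH].
  by apply: (Cn_eq openT _ (Cn_cst n _ 1)) => v _; rewrite /monom big_nil.
by apply: (Cn_eq openT _ (CnM openT (Cn_coord n j) IH)) => v _; rewrite monom_cons.
Qed.

Lemma monom_le w v e : `|v| <= e -> `|monom w v| <= e ^+ size w.
Proof.
move=> ve; elim: w => [|j w IH]; first by rewrite /monom big_nil normr1 expr0.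
rewrite monom_cons normrM exprS; apply: ler_pM => //.
exact: le_trans (coord_le_norm v j) ve.
Qed.

Lemma monomZ w c v : monom w (c *: v) = c ^+ size w * monom w v.
Proof.
elim: w => [|j w IH]; first by rewrite /monom !big_nil mul1r.
by rewrite !monom_cons IH mxE /= exprS; ring.
Qed.

(** The terms of the Leibniz rule as pairs (coefficient, word with one letter deleted). Kept as a
    list, since the estimates need their number, the size of their coefficients and their degree. *)
Fixpoint dmonom (h : 'rV[R]_m) w : seq (R * seq 'I_m) :=
  if w is j :: w' then
    (h 0 j, w') :: [seq (p.1, j :: p.2) | p <- dmonom h w']
  else [::].

Lemma size_dmonom h w : size (dmonom h w) = size w.
Proof. by elim: w => //= j w IH; rewrite size_map IH. Qed.

Lemma dmonomP h w p : p \in dmonom h w -> `|p.1| <= `|h| /\ (size p.2).+1 = size w.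
Proof.
elim: w p => //= j w IH p; rewrite inE => /predU1P[-> //=|/mapP[q /IH[h1 h2] ->] /=].
  by split=> //; exact: coord_le_norm.
by rewrite h2.
Qed.

Lemma derive_monom h w v : 'D_h (monom w) v = \sum_(p <- dmonom h w) p.1 * monom p.2 v.
Proof.
elim: w => [|j w IH] /=.
  rewrite big_nil (_ : monom [::] = cst 1) ?derive_cst//.
  by apply/funext => x; rewrite /monom big_nil.
have -> : monom (j :: w) = (fun v => v 0 j * monom w v).
  by apply/funext => x; rewrite monom_cons.
have [dc Dc] := derivable_coord j v h.
rewrite (derive_mul dc (Cn_derivable (Cn_monom 0 w) I)).2.
rewrite Dc IH big_cons big_map /= addrC mulrC; congr (_ + _).
by rewrite mulr_sumr; apply: eq_bigr => p _; rewrite monom_cons mulrCA.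
Qed.

End euclid.

(** * Iterated derivatives of sums and of dilated functions *)

Section rderives_theory.
Variables (R : realType) (E : normedModType R).
Implicit Types (W : set E) (g : E -> R).

Lemma rderives_eq W s (g h : E -> R) : open W -> {in W, g =1 h} ->
  {in W, rderives s g =1 rderives s h}.
Proof.
move=> oW gh; elim: s => //= k s IH x /set_mem Wx.
exact: near_eq_derive (open_near_eq oW IH Wx).
Qed.

Lemma rderives_cst0 s : rderives s (fun _ : E => 0) = (fun _ : E => 0) :> (E -> R).
Proof.
by elim: s => //= h s ->; apply/funext => x; exact: derive_cst.
Qed.

Lemma Cn_lincomb n W (I : Type) (r : seq I) (c : I -> R) (G : I -> E -> R) :
  open W -> (forall i, Cn n W (G i)) ->
  Cn n W (fun x => \sum_(i <- r) c i * G i x).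
Proof. by move=> oW Gn; apply: Cn_sum => // i; exact: CnZ. Qed.

Lemma rderives_sum W s (I : Type) (r : seq I) (c : I -> R) (G : I -> E -> R) :
  open W -> (forall i n, Cn n W (G i)) ->
  {in W, rderives s (fun y => \sum_(i <- r) c i * G i y) =1
     fun x => \sum_(i <- r) c i * rderives s (G i) x}.
Proof.
move=> oW Gn; elim: s => [|h s IH] x xW //=.
rewrite (near_eq_derive h (open_near_eq oW IH (set_mem xW))).
apply: (derive_lincomb _ _ _).2 => i.
exact: Cn_derivable (Cn_rderives (Gn i (size s + 0)%N)) (set_mem xW).
Qed.

Lemma derive_scale g (c : R) x h :
  'D_h (fun v => g (c *: v)) x = 'D_(c *: h) g (c *: x).
Proof.
rewrite /derive.
set g1 := fun t : R => t^-1 *: _; set g2 := fun t : R => t^-1 *: _.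
suff -> : g1 = g2 by [].
by apply/funext => t; rewrite /g1 /g2 /= (scalerDr c) !scalerA mulrC.
Qed.

Lemma derive_dirZ g (c : R) x h : derivable g x h ->
  'D_(c *: h) g x = c * 'D_h g x.
Proof.
have e (G : E -> R) w : 'D_w G x = 'D_1 (fun t : R => G (t *: w + x)) 0.
  rewrite /derive; set g1 := fun t : R => t^-1 *: _; set g2 := fun t : R => t^-1 *: _.
  suff -> : g1 = g2 by [].
  by apply/funext => t; rewrite /g1 /g2 /= addr0 scale0r add0r [_%:A]mulr1.
move=> /derivable1P dg; rewrite !e.
pose k (t : R) := g (t *: h + x).
have -> : (fun t : R => g (t *: (c *: h) + x)) = (fun t : R => k (c * t)).
  by apply/funext => t; rewrite /k scalerA mulrC.
have dc : is_derive (0 : R) 1 (fun t : R => c * t) c.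
  apply: is_derive_eq (is_deriveZ c (is_derive_id (0 : R) 1)) _.
  by rewrite [LHS]mulr1.
have dk : derivable k (c * 0) 1 by rewrite mulr0.
have [_ ->] := derivable_derive_comp (@ex_derive _ _ _ _ _ _ _ dc) dk.
by rewrite mulr0 mulrC (@derive_val _ _ _ _ _ _ _ dc).
Qed.

Lemma Cn_scale n (c : R) g : Cn n [set: E] g -> Cn n [set: E] (fun v => g (c *: v)).
Proof.
move=> gn.
exact: (@Cn_comp_linear R E E n [set: E] (GRing.scale c) g (@scaler_continuous _ _ c) gn).1.
Qed.

Lemma rderives_scale g (c : R) s v : (forall n, Cn n [set: E] g) ->
  rderives s (fun v => g (c *: v)) v = c ^+ size s * rderives s g (c *: v).
Proof.
move=> gn; elim: s v => [|h s IH] v /=; first by rewrite mul1r.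
have -> : rderives s (fun v => g (c *: v)) =
    (fun v => c ^+ size s * rderives s g (c *: v)) by apply/funext => y; exact: IH.
have dg x w : derivable (rderives s g) x w.
  exact: Cn_derivable (Cn_rderives (gn (size s + 0)%N)) I.
have dg' : derivable (fun v => rderives s g (c *: v)) v h.
  exact: Cn_derivable (Cn_scale c (Cn_rderives (gn (size s + 0)%N))) I.
rewrite (derive_scalel _ dg').2 (derive_scale (rderives s g)) (derive_dirZ _ (dg _ _)).
by rewrite exprSr mulrA.
Qed.

End rderives_theory.

(** * Derivatives of cut-off monomials, uniformly in the word and the radius *)

Section cut_monomials.
Variables (R : realType) (m : nat).
Implicit Types (v x : 'rV[R]_m) (w : seq 'I_m) (chi : 'rV[R]_m -> R).

(** A class containing the bump and stable under differentiation, so that induction on the order of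
    derivation can pass to derivatives of the cutoff. The strict inequality makes the region of
    vanishing open. *)
Definition cutlike chi := (forall n, Cn n [set: 'rV[R]_m] chi) /\
  (forall x, 1 < enorm x -> chi x = 0).

Lemma cutlike_bump : cutlike (@ebump R m).
Proof. by split=> [n|x /ltW]; [exact: Cn_ebump|exact: ebump_eq0]. Qed.

Lemma open_enorm_gt e : 0 <= e -> open [set v : 'rV[R]_m | e < enorm v].
Proof.
move=> e0; have -> : [set v : 'rV[R]_m | e < enorm v] =
    (@sqnorm R m) @^-1` [set y | e ^+ 2 < y].
  apply/seteqP; split=> v /=; rewrite -sqr_enorm.
    by move=> h; rewrite ltr_pXn2r ?nnegrE ?enorm_ge0.
  by rewrite ltr_pXn2r ?nnegrE ?enorm_ge0.
apply: open_comp; last exact: open_gt.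
by move=> v _; exact: Cn_cont (Cn_sqnorm R m 0) I.
Qed.

Lemma open_enorm_lt e : 0 <= e -> open [set v : 'rV[R]_m | enorm v < e].
Proof.
move=> e0; have -> : [set v : 'rV[R]_m | enorm v < e] =
    (@sqnorm R m) @^-1` [set y | y < e ^+ 2].
  apply/seteqP; split=> v /=; rewrite -sqr_enorm.
    by move=> h; rewrite ltr_pXn2r ?nnegrE ?enorm_ge0.
  by rewrite ltr_pXn2r ?nnegrE ?enorm_ge0.
apply: open_comp; last exact: open_lt.
by move=> v _; exact: Cn_cont (Cn_sqnorm R m 0) I.
Qed.

Lemma rderives_vanish (W : set 'rV[R]_m) (g : 'rV[R]_m -> R) s v :
  open W -> (forall x, W x -> g x = 0) -> W v -> rderives s g v = 0.
Proof.
move=> oW g0 Wv.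
have g0' : {in W, g =1 (fun _ => 0)} by move=> x /set_mem; exact: g0.
by rewrite (rderives_eq s oW g0' (mem_set Wv)) rderives_cst0.
Qed.

Lemma cutlike_derive chi h : cutlike chi -> cutlike (fun x => 'D_h chi x).
Proof.
move=> [cn c0]; split=> [n|x x1]; first exact: Cn_derive (cn n.+1).
exact: (rderives_vanish [:: h] (open_enorm_gt ler01) c0 x1).
Qed.

Lemma cutlike_bounded chi : cutlike chi -> exists C, 0 <= C /\
  forall x, `|chi x| <= C.
Proof.
move=> [cn c0]; pose A := [set v : 'rV[R]_m | forall i, `[-1, 1]%classic (v 0 i)].
have cA : compact A by apply: (@rV_compact _ _ (fun _ : 'I_m => `[(-1 : R), 1]%classic)) => i; exact: segment_compact.
have A0 : A !=set0 by exists 0 => i /=; rewrite mxE in_itv/= lerN10 ler01.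
have [|c cA' cmax] := EVT_max_rV (f := fun x => `|chi x|) A0 cA.
  apply: continuous_subspaceT => x; apply: continuous_comp; last exact: norm_continuous.
  exact: Cn_cont (cn 0%N) I.
exists `|chi c|; split=> // x.
have [x1|x1] := ltP 1 (enorm x); first by rewrite c0// normr0.
apply: cmax; apply/mem_set => i /=.
by rewrite in_itv/= -ler_norml (le_trans (coord_le_enorm x i)).
Qed.

(* [C] does not depend on [w]: the Leibniz rule only costs a power of its size. *)
Lemma monom_cut_bound s chi : cutlike chi -> exists C, 0 <= C /\ forall w x,
  `|rderives s (fun y => monom w y * chi y) x| <=
    C * (size w).+1%:R ^+ size s * `|x| ^+ (size w - size s).
Proof.
elim/last_ind: s chi => [|s h IH] chi cc.
  have [C [C0 HC]] := cutlike_bounded cc; exists C; split=> // w x /=.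
  rewrite expr0 mulr1 subn0 normrM mulrC; apply: ler_pM => //.
  exact: monom_le (lexx _).
have [C1 [C10 H1]] := IH _ cc.
have [C2 [C20 H2]] := IH _ (cutlike_derive h cc).
exists (`|h| * C1 + C2); split=> [|w x]; first by rewrite addr_ge0// mulr_ge0.
rewrite size_rcons rderives_rcons.
(* Outside the unit ball the left side is 0. Inside, |x| <= 1 allows the exponent of |x| to drop by
   one in the term where the cutoff is differentiated. *)
have [x1|x1] := ltP 1 (enorm x).
  rewrite -rderives_rcons (rderives_vanish _ (open_enorm_gt ler01) _ x1); last first.
    by move=> y y1; rewrite cc.2 ?mulr0.
  by rewrite normr0 !mulr_ge0// ?addr_ge0 ?mulr_ge0// ?exprn_ge0.
have {}x1 := le_trans (norm_le_enorm x) x1.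
have [cn _] := cc.
(* The two halves of the Leibniz rule are written as a sum over booleans with coefficients 1, the
   shape that [rderives_sum] handles. *)
have Dprod y : 'D_h (fun y => monom w y * chi y) y =
    \sum_(i <- [:: true; false]) 1 * (if i then
      \sum_(p <- dmonom h w) p.1 * (monom p.2 y * chi y)
      else monom w y * 'D_h chi y).
  rewrite !big_cons big_nil addr0 !mul1r.
  rewrite (derive_mul (Cn_derivable (Cn_monom R 0 w) I) (Cn_derivable (cn 0%N) I)).2.
  rewrite addrC derive_monom mulr_sumr; congr (_ + _).
  by apply: eq_bigr => p _; ring.
have Cm n (p : R * seq 'I_m) : Cn n [set: 'rV[R]_m] (fun y => monom p.2 y * chi y).
  by apply: CnM openT (Cn_monom _ _ _) (cn n).
rewrite (rderives_eq (W := setT) s openT (fun y _ => Dprod y) (mem_set I)).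
rewrite (rderives_sum (W := setT) s _ _ openT _ (mem_set I)); last first.
  move=> [] n; first by apply: Cn_lincomb openT _.
  by apply: CnM openT (Cn_monom _ _ _) _; exact: Cn_derive (cn n.+1).
rewrite !big_cons big_nil addr0 !mul1r.
rewrite (rderives_sum (W := setT) s _ _ openT _ (mem_set I))//.
have nx : 0 <= `|x| by [].
set N := (size w).+1%:R; have N1 : 1 <= N by rewrite ler1n.
apply: le_trans (ler_normD _ _) _.
rewrite mulrDl mulrDl; apply: lerD.
  apply: le_trans (ler_norm_sum _ _ _) _.
  apply: le_trans (_ : \sum_(p <- dmonom h w)
     `|h| * (C1 * N ^+ size s * `|x| ^+ (size w - (size s).+1)) <= _).
    rewrite !big_seq; apply: ler_sum => p /dmonomP[p1 p2].
    rewrite normrM; apply: ler_pM => //; apply: le_trans (H1 _ _) _.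
    rewrite p2 -p2 subSS; apply: ler_pM => //.
      by rewrite mulr_ge0// ?exprn_ge0.
    apply: ler_pM => //.
    by apply: lerXn2r; rewrite ?nnegrE// ler_nat p2 -p2.
  (* There are [size w] terms, at most N: this is the one extra power of N per derivative. *)
  rewrite big_const_seq count_predT size_dmonom iter_addr addr0 exprS -mulr_natl.
  rewrite [leRHS](_ : _ = N * (`|h| * (C1 * N ^+ size s * `|x| ^+ (size w - (size s).+1)))); last by ring.
  apply: ler_wpM2r; last by rewrite ler_nat.
  by rewrite !mulr_ge0// ?exprn_ge0// (le_trans ler01).
apply: le_trans (H2 _ _) _.
have N0 := le_trans ler01 N1.
apply: ler_pM; rewrite ?mulr_ge0 ?exprn_ge0//.
  by apply: ler_wpM2l => //; apply: ler_weXn2l.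
by apply: ler_wiXn2l => //; rewrite subnS leq_pred.
Qed.

Definition cut_monom (rho : R) w v : R := monom w v * ebump (rho^-1 *: v).

Lemma Cn_cut_monom n rho w : Cn n [set: 'rV[R]_m] (cut_monom rho w).
Proof. exact: CnM openT (Cn_monom _ _ _) (Cn_scale _ (Cn_ebump _ _ _)). Qed.

Lemma cut_monom_vanish rho s w v : 0 < rho -> rho < enorm v ->
  rderives s (cut_monom rho w) v = 0.
Proof.
move=> r0 rv; apply: (rderives_vanish _ (open_enorm_gt (ltW r0)) _ rv) => x /= rx.
rewrite /cut_monom ebump_eq0 ?mulr0// enormZ gtr0_norm ?invr_gt0//.
by rewrite ler_pdivlMl// mulr1 ltW.
Qed.

(** By homogeneity the function is rho^k times the unit-scale one at v / rho. Differentiation brings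
    rho^-|s| and the bound brings (|v| / rho)^(k - |s|), so all powers of rho cancel and C is
    independent of rho. *)
Lemma cut_monom_bound s : exists C, 0 <= C /\ forall rho w v, 0 < rho ->
  (size s <= size w)%N ->
  `|rderives s (cut_monom rho w) v| <=
    C * (size w).+1%:R ^+ size s * `|v| ^+ (size w - size s).
Proof.
have [C [C0 HC]] := monom_cut_bound s cutlike_bump.
exists C; split=> // rho w v r0 sw.
pose g := fun y : 'rV[R]_m => monom w y * ebump y.
have gn n : Cn n [set: 'rV[R]_m] g by apply: CnM openT (Cn_monom _ _ _) (Cn_ebump _ _ _).
have E : {in [set: 'rV[R]_m], cut_monom rho w =1
    fun v => \sum_(i <- [:: tt]) rho ^+ size w * g (rho^-1 *: v)}.
  move=> y _; rewrite big_seq1 /g monomZ /cut_monom !mulrA -exprMn mulfV ?gt_eqF//.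
  by rewrite expr1n mul1r.
rewrite (rderives_eq s openT E (mem_set I)).
rewrite (rderives_sum s [:: tt] _ (G := fun _ v => g (rho^-1 *: v)) openT _ (mem_set I)); last first.
  by move=> _ n; exact: Cn_scale.
rewrite big_seq1 rderives_scale// normrM normrM !normrX normfV (gtr0_norm r0).
have e : rho ^+ size w * rho^-1 ^+ size s = rho ^+ (size w - size s).
  by rewrite -{1}(subnK sw) exprD -mulrA -exprMn mulfV ?gt_eqF// expr1n mulr1.
rewrite mulrA e.
apply: le_trans (ler_wpM2l _ (HC w _)) _; first by rewrite exprn_ge0// ltW.
rewrite normrZ normfV (gtr0_norm r0) exprMn.
rewrite mulrCA; apply: ler_wpM2l; first by rewrite mulr_ge0// ?exprn_ge0.
by rewrite mulrA -exprMn mulfV ?gt_eqF// expr1n mul1r.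
Qed.

End cut_monomials.

(** * Regular sequences *)

Lemma powR_rootK (R : realType) (q : R) n : 0 <= q ->
  (q `^ (n.+1%:R^-1)) ^+ n.+1 = q.
Proof.
by move=> q0; rewrite -powR_mulrn ?powR_ge0// -powRrM mulVf ?pnatr_eq0// powRr1.
Qed.

Section regular_sequences.
Variables (R : realType) (M : nat -> R).
Hypothesis regM : regular M.
Let mu := wquot M.

Lemma regular_M_ge0 k : 0 <= M k. Proof. by case: regM. Qed.

(** Both halves are proved together: the log-convexity step divides by [mu k], which must be known
    to be positive. *)
Lemma wquot_ge1_mono k : 1 <= mu k /\ mu k <= mu k.+1.
Proof.
case: regM => M0 [m0 m1] lc _ _; elim: k => [|k [h1 h2]].
  by rewrite /mu m0 m1.
have k1 : 1 <= mu k.+1 := le_trans h1 h2.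
split=> //; have := lc k.+1 isT => /= h.
have p : 0 < mu k by exact: lt_le_trans ltr01 h1.
have : mu k * mu k.+1 <= mu k * mu k.+2.
  apply: le_trans h; rewrite expr2; apply: ler_wpM2r => //.
  exact: le_trans ler01 k1.
by rewrite ler_pM2l.
Qed.

Lemma wquot_gt0 k : 0 < mu k.
Proof. by apply: lt_le_trans ltr01 _; exact: (wquot_ge1_mono k).1. Qed.

Lemma wquotE k : M k = mu k * k`!%:R.
Proof. by rewrite /mu /wquot divfK// pnatr_eq0 -lt0n fact_gt0. Qed.

Definition wratio k := mu k / mu k.+1.

Lemma wratio_gt0 k : 0 < wratio k.
Proof. by rewrite divr_gt0 ?wquot_gt0. Qed.

Lemma wratio_ninc k l : (k <= l)%N -> wratio l <= wratio k.
Proof.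
elim: l => [|l IH]; first by rewrite leqn0 => /eqP ->.
rewrite leq_eqVlt => /predU1P[-> //|/IH]; apply: le_trans.
rewrite /wratio ler_pdivrMr ?wquot_gt0// mulrAC ler_pdivlMr ?wquot_gt0//.
by case: regM => _ _ lc _ _; have := lc l.+1 isT; rewrite expr2.
Qed.

(** Ratios bounded below by e would give m_k <= e^-k, hence bounded roots m_k^(1/k), against the
    last regularity condition. *)
Lemma wratio_cvg0 e : 0 < e -> exists k, wratio k < e.
Proof.
move=> e0; apply: contrapT => H.
have re k : e <= wratio k by rewrite leNgt; apply/negP => h; apply: H; exists k.
have mule k : mu k <= e^-1 ^+ k.
  elim: k => [|k IH]; first by case: regM => _ [m0 _] _ _ _; rewrite /mu m0.
  have := re k; rewrite /wratio ler_pdivlMr ?wquot_gt0// mulrC -ler_pdivlMr//.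
  by move=> h; apply: le_trans h _; rewrite exprSr ler_pM2r ?invr_gt0.
case: regM => _ _ _ _ /cvgryPge /(_ (e^-1 + 1)) [N _ HN].
have := HN N.+1 (leqnSn N); rewrite /= leNgt => /negP; apply.
have p : mu N.+1 `^ (N.+1%:R^-1) <= (e^-1 ^+ N.+1) `^ (N.+1%:R^-1).
  apply: ge0_ler_powR; rewrite ?invr_ge0 ?nnegrE ?exprn_ge0 ?invr_ge0//.
  - exact/ltW/wquot_gt0.
  - exact: ltW.
apply: le_lt_trans p _.
rewrite -powR_mulrn ?invr_ge0 ?ltW// -powRrM mulfV ?pnatr_eq0// powRr1 ?invr_ge0 ?ltW//.
by rewrite ltrDl.
Qed.

(** Passing from index j to j + 1 multiplies [mu j * y ^+ j] by y / r_j. As r_j decreases, y <=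
    r_{k-1} makes all steps up to k decreasing; [wquot_pow_ge] is the increasing half. *)
Lemma wquot_pow_le k l y : 0 <= y -> (l <= k)%N ->
  ((l < k)%N -> y <= wratio k.-1) -> mu k * y ^+ k <= mu l * y ^+ l.
Proof.
move=> y0; elim: k => [|k IH]; first by rewrite leqn0 => /eqP ->.
rewrite leq_eqVlt => /predU1P[-> //|lk] /(_ lk) /= yk.
apply: le_trans (IH lk _); last first.
  move=> _; apply: le_trans yk _; apply: wratio_ninc; exact: leq_pred.
rewrite exprS mulrA; apply: ler_wpM2r; first exact: exprn_ge0.
by rewrite mulrC -ler_pdivlMr ?wquot_gt0.
Qed.

Lemma wquot_pow_ge k l y : 0 <= y -> (k <= l)%N -> wratio k <= y ->
  mu k * y ^+ k <= mu l * y ^+ l.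
Proof.
move=> y0 kl yk; elim: l kl => [|l IH]; first by rewrite leqn0 => /eqP ->.
rewrite leq_eqVlt => /predU1P[-> //|kl]; apply: le_trans (IH kl) _.
rewrite exprS mulrA; apply: ler_wpM2r; first exact: exprn_ge0.
rewrite mulrC -ler_pdivrMr ?wquot_gt0//.
apply: le_trans _ yk; exact: (@wratio_ninc k l kl).
Qed.

(* Around the radius where the [k]-th term of [sum_k mu k y^k] is active, that
   term is comparable with the infimum of all terms at a doubled radius. *)
Lemma wquot_pow_inf k l y : 0 <= y ->
  ((0 < k)%N -> y <= wratio k.-1) -> wratio k <= 2 * y ->
  mu k * y ^+ k <= mu l * (2 * y) ^+ l.
Proof.
move=> y0 h1 h2; have yy : y <= 2 * y by lra.
have y20 : 0 <= 2 * y by lra.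
have [lk|kl] := leqP l k.
  apply: le_trans (wquot_pow_le y0 lk _) _.
    by move=> lk'; apply: h1; exact: leq_ltn_trans lk'.
  by rewrite ler_pM2l ?wquot_gt0//; apply: lerXn2r.
apply: le_trans (wquot_pow_ge y20 (ltnW kl) h2).
by rewrite ler_pM2l ?wquot_gt0//; apply: lerXn2r.
Qed.

Lemma wquot_growth : exists A, 1 <= A /\ forall k, mu k.+1 <= A ^+ k * mu k.
Proof.
case: regM => _ [m0 m1] _ [A HA] _; exists (Num.max 1 A).
split=> [|[|k]]; first by rewrite le_max lexx.
  (* The root condition starts at k = 1; the normalisation m_0 = m_1 = 1 covers k = 0. *)
  by rewrite /mu m0 m1 mulr1.
rewrite -ler_pdivrMr ?wquot_gt0//.
have h : (mu k.+2 / mu k.+1) `^ (k.+1%:R^-1) <= Num.max 1 A.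
  by rewrite le_max; apply/orP; right; apply: HA; exists k.+1.
have q0 : 0 <= mu k.+2 / mu k.+1 by rewrite divr_ge0 ?ltW ?wquot_gt0.
rewrite -[leLHS](powR_rootK k q0).
by apply: lerXn2r; rewrite ?nnegrE ?powR_ge0// le_max ler01.
Qed.

(** For fixed g the loss is geometric in k, with base A^g. This dependence of the base on g is why
    kappa must be fixed before lam. *)
Lemma wquot_shift A : 1 <= A -> (forall k, mu k.+1 <= A ^+ k * mu k) ->
  forall k g, mu (k + g)%N <= A ^+ ((k + g) * g) * mu k.
Proof.
move=> A1 HA k; elim=> [|g IH]; first by rewrite addn0 muln0 mul1r.
have A0 := le_trans ler01 A1.
rewrite addnS; apply: le_trans (HA _) _.
apply: le_trans (ler_wpM2l _ IH) _; first exact: exprn_ge0.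
rewrite mulrA -exprD; apply: ler_wpM2r; first exact/ltW/wquot_gt0.
by apply: ler_weXn2l => //; rewrite mulnS mulSn leq_add// leq_addl.
Qed.

(** The minimum is at most its term of index k; clearing the root leaves a base H independent of
    g. *)
Lemma moderate_growthP : moderate_growth M -> exists H, 1 <= H /\
  forall k g, M (k + g)%N <= H ^+ (k + g).+1 * (M k * M g).
Proof.
move=> [H HH]; exists (Num.max 1 H); split=> [|k g]; first by rewrite le_max lexx.
set n := (k + g)%N; pose mn := \big[Num.min/(M 0%N * M n)]_(i < n.+1) (M i * M (n - i)%N).
have Mgt0 j : 0 < M j by rewrite wquotE mulr_gt0 ?wquot_gt0// ltr0n fact_gt0.
have mn0 : 0 < mn.
  by apply: (big_ind (fun x => 0 < x)) => [|x y x0 y0|i _]; rewrite ?lt_min ?x0 ?mulr_gt0.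
have mnle : mn <= M k * M g.
  have kn : (k < n.+1)%N by rewrite ltnS leq_addr.
  have := @bigmin_le _ _ _ (M 0%N * M n) (Ordinal kn) (fun i : 'I_n.+1 => M i * M (n - i)%N).
  by rewrite /= /n addKn.
have h : (M n / mn) `^ (n.+1%:R^-1) <= Num.max 1 H.
  by rewrite le_max; apply/orP; right; apply: HH; exists n.
have q0 : 0 <= M n / mn by rewrite divr_ge0 ?ltW.
have q1 : M n / mn <= Num.max 1 H ^+ n.+1.
  rewrite -[leLHS](powR_rootK n q0).
  by apply: lerXn2r; rewrite ?nnegrE ?powR_ge0// le_max ler01.
rewrite ler_pdivrMr// in q1; apply: le_trans q1 _.
by apply: ler_wpM2l mnle; rewrite exprn_ge0// le_max ler01.
Qed.

End regular_sequences.

(** * Series of cut-off monomials *)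

Section flat_extension.
Variables (R : realType) (E : normedModType R).

(** Flatness of a derivative, together with its value 0 at the origin, forces each next derivative
    to vanish there too; so the values at 0 are obtained order by order from bounds off the
    origin. *)
Lemma flat_Cn n (g : E -> R) : (forall k, Cn k [set v | v != 0] g) -> g 0 = 0 ->
  (forall s, (size s <= n)%N -> exists C, forall v, v != 0 ->
     `|rderives s g v| <= C * `|v| ^+ 2) -> Cn n [set: E] g.
Proof.
move=> gn g0 H.
have ext s C : rderives s g 0 = 0 ->
    (forall v, v != 0 -> `|rderives s g v| <= C * `|v| ^+ 2) ->
    forall v, `|rderives s g v| <= C * `|v| ^+ 2.
  move=> z HC v; have [->|/HC//] := eqVneq v 0.
  by rewrite z !normr0 expr2 !mulr0.
have z s : (size s <= n)%N -> rderives s g 0 = 0.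
  elim: s => //= h s IH sn; have [C HC] := H s (ltnW sn).
  by have [_ _ ->] := flat_derivative (ext _ _ (IH (ltnW sn)) HC).
apply: rderives_Cn => s sn; have [C HC] := H s sn.
have [c d _] := flat_derivative (ext _ _ (z _ sn) HC).
have Cs := Cn_rderives (gn (size s + 0)%N).
split=> [x _|x w _]; have [->|x0] := eqVneq x 0.
- exact: c.
- exact: Cn_cont Cs x0.
- exact: d.
- exact: Cn_derivable Cs x0.
Qed.

End flat_extension.

(** * Absorbing factorials and polynomial factors into geometric ones *)

Section counting.
Variable R : realType.

Lemma bin_le_exp2 n k : ('C(n, k) <= 2 ^ n)%N.
Proof.
have [kn|kn] := leqP k n; last by rewrite bin_small.
rewrite -[2%N]/(1 + 1)%N expnDn (bigD1 (Ordinal (kn : (k < n.+1)%N)))//=.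
by rewrite !exp1n !muln1 leq_addr.
Qed.

Lemma fact_add_le k g : (((k + g)`!)%:R : R) <= k`!%:R * (g`!%:R * 2 ^+ (k + g)).
Proof.
have h := bin_fact (leq_addl k g).
rewrite -h addnK -natrX -!natrM ler_nat mulnC [(g`! * k`!)%N]mulnC -mulnA.
by rewrite !leq_mul2l bin_le_exp2 !orbT.
Qed.

(** From (k+1)^s k! <= (k+s)! and the bound 2^(k+s) on binomial coefficients. *)
Lemma expS_le s k : ((k.+1%:R : R) ^+ s) <= s`!%:R * 2 ^+ (k + s).
Proof.
have h : (k.+1 ^ s * k`! <= (k + s)`!)%N.
  elim: s => [|s IH]; first by rewrite expn0 mul1n addn0.
  rewrite addnS factS expnS -mulnA; apply: leq_mul => //.
  by rewrite ltnS leq_addr.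
have f0 : (0 : R) < k`!%:R by rewrite ltr0n fact_gt0.
rewrite -(ler_pM2l f0); apply: le_trans (fact_add_le k s).
by rewrite -natrX -natrM ler_nat mulnC.
Qed.

Lemma sum_geom2 K : \sum_(k < K) (2^-1 : R) ^+ k <= 2.
Proof.
suff -> : \sum_(k < K) (2^-1 : R) ^+ k = 2 - 2 * 2^-1 ^+ K.
  by rewrite lerBlDr lerDl mulr_ge0// exprn_ge0// invr_ge0.
elim: K => [|K IH]; first by rewrite big_ord0 expr0; lra.
by rewrite big_ord_recr /= IH exprS; lra.
Qed.

End counting.

Section words.
Variables (m : nat).

Fixpoint words k : seq (seq 'I_m) :=
  if k is k'.+1 then [seq j :: w | j <- enum 'I_m, w <- words k'] else [:: [::]].

Lemma size_of_words k w : w \in words k -> size w = k.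
Proof.
elim: k w => [|k IH] w /=; first by rewrite inE => /eqP ->.
by move=> /allpairsP[[j w'] [_ /= /IH <- ->]].
Qed.

Lemma size_words k : size (words k) = (m ^ k)%N.
Proof. by elim: k => //= k IH; rewrite size_allpairs IH size_enum_ord expnS. Qed.

Lemma big_wordsS (V : nmodType) k (F : seq 'I_m -> V) :
  \sum_(w <- words k.+1) F w = \sum_(j < m) \sum_(w <- words k) F (j :: w).
Proof. by rewrite /= big_allpairs_dep big_enum. Qed.

End words.

Section words_lt.
Variable m : nat.

Fixpoint words_lt k : seq (seq 'I_m) :=
  if k is k'.+1 then words_lt k' ++ words m k' else [::].

Lemma size_of_words_lt k w : w \in words_lt k -> (size w < k)%N.
Proof.
elim: k => //= k IH; rewrite mem_cat => /orP[/IH|/size_of_words ->//].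
exact: leqW.
Qed.

Lemma big_words_lt (V : nmodType) k (F : seq 'I_m -> V) :
  \sum_(w <- words_lt k) F w = \sum_(i < k) \sum_(w <- words m i) F w.
Proof.
elim: k => [|k IH]; first by rewrite big_ord0 big_nil.
by rewrite big_cat big_ord_recr /= IH.
Qed.

Lemma words_lt_widen (V : nmodType) k l (F : seq 'I_m -> V) : (l <= k)%N ->
  (forall w, (l <= size w)%N -> F w = 0) ->
  \sum_(w <- words_lt k) F w = \sum_(w <- words_lt l) F w.
Proof.
move=> lk F0; elim: k lk => [|k IH]; first by rewrite leqn0 => /eqP ->.
rewrite leq_eqVlt => /predU1P[-> //|lk] /=; rewrite big_cat IH//=.
have -> : \sum_(w <- words m k) F w = 0; last by rewrite addr0.
by rewrite big_seq big1// => w /size_of_words wk; apply: F0; rewrite wk.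
Qed.

End words_lt.

Section cut_series.
Variables (R : realType) (m : nat) (M : nat -> R) (lam : R).
Hypotheses (regM : regular M) (lam0 : 0 < lam).
Implicit Types (v : 'rV[R]_m) (w : seq 'I_m).

Definition wradius k : R := wratio M k / lam.

Lemma wradius_gt0 k : 0 < wradius k.
Proof. by rewrite divr_gt0// wratio_gt0. Qed.

Lemma wradius_ninc k l : (k <= l)%N -> wradius l <= wradius k.
Proof. by move=> kl; rewrite ler_pM2r ?invr_gt0// wratio_ninc. Qed.

Lemma enorm_gt0 v : v != 0 -> 0 < enorm v.
Proof. by move=> v0; apply: lt_le_trans (norm_le_enorm v); rewrite normr_gt0. Qed.

Lemma wradius_lt e : 0 < e -> exists k, wradius k < e.
Proof.
move=> e0; have [|k hk] := wratio_cvg0 regM (e := e * lam); first exact: mulr_gt0.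
by exists k; rewrite /wradius ltr_pdivrMr.
Qed.

(* The second branch is [v = 0], where only the empty word must survive. *)
Definition level v : nat :=
  if pselect (exists k, wradius k < enorm v) is left e then ex_minn e else 1%N.

Lemma level0 : level 0 = 1%N.
Proof.
rewrite /level; case: pselect => // -[k]; rewrite enorm0 => h; exfalso.
by move: h; rewrite ltNge ltW ?wradius_gt0.
Qed.

Lemma level_wradius v : v != 0 -> wradius (level v) < enorm v.
Proof.
move=> v0; rewrite /level; case: pselect => [e|[]]; first by case: ex_minnP.
exact/wradius_lt/enorm_gt0.
Qed.

Lemma level_le v k : wradius k < enorm v -> (level v <= k)%N.
Proof.
move=> h; rewrite /level; case: pselect => [e|[]]; last by exists k.
by case: ex_minnP => n _; apply.
Qed.

Definition cut_word w : 'rV[R]_m -> R := cut_monom (wradius (size w)) w.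

Lemma Cn_cut_word n w : Cn n [set: 'rV[R]_m] (cut_word w).
Proof. exact: Cn_cut_monom. Qed.

Lemma cut_word_eq0 v w : (level v <= size w)%N -> cut_word w v = 0.
Proof.
move=> lw; rewrite /cut_word /cut_monom; have [v0|v0] := eqVneq v 0.
  move: lw; rewrite v0 level0; case: w => // j w _.
  by rewrite monom_cons mxE !mul0r.
rewrite ebump_eq0 ?mulr0// enormZ gtr0_norm ?invr_gt0 ?wradius_gt0//.
rewrite ler_pdivlMl ?wradius_gt0// mulr1.
exact: le_trans (wradius_ninc lw) (ltW (level_wradius v0)).
Qed.

(* The sum over all words: those of length at least [level v] contribute 0. *)
Definition cut_series (c : seq 'I_m -> R) v : R :=
  \sum_(w <- words_lt m (level v)) c w * cut_word w v.

Lemma cut_seriesE c v k : (level v <= k)%N ->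
  cut_series c v = \sum_(w <- words_lt m k) c w * cut_word w v.
Proof.
by move=> lk; rewrite (words_lt_widen lk)// => w /cut_word_eq0 ->; rewrite mulr0.
Qed.

Definition level_set k := [set v : 'rV[R]_m | wradius k < enorm v].

Lemma open_level_set k : open (level_set k).
Proof. exact/open_enorm_gt/ltW/wradius_gt0. Qed.

Lemma cut_series_near c k :
  {in level_set k, cut_series c =1
     fun v => \sum_(w <- words_lt m k) c w * cut_word w v}.
Proof. by move=> v /set_mem /level_le; exact: cut_seriesE. Qed.

Lemma Cn_cut_series_neq0 c n : Cn n [set v | v != 0] (cut_series c).
Proof.
apply: Cn_local => v v0; exists (level_set (level v)); split.
  exact: level_wradius.
have oL := @open_level_set (level v).
pose G (x : 'rV[R]_m) := \sum_(w <- words_lt m (level v)) c w * cut_word w x.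
have GE : {in level_set (level v), G =1 cut_series c}.
  by move=> x xk; rewrite (cut_series_near c xk).
apply: (Cn_eq oL GE); apply: Cn_lincomb oL _.
by move=> w; apply: Cn_sub (Cn_cut_word _ _).
Qed.

(** On the support, y = lam |v| <= r_{k-1}, so m_k y^k <= m_{t+2} y^(t+2) with t = |s|: high powers
    of |v| are traded for the two that flatness requires, after t are spent on derivatives. The
    factor (k+1)^t is absorbed by 2^k, written as 4^k 2^-k so that 4^k cancels against [coef_bound]
    and 2^-k remains summable. *)
Lemma cut_word_bound s : exists C, 0 <= C /\ forall w v,
  ((size s).+2 <= size w)%N -> v != 0 ->
  `|rderives s (cut_word w) v| * (lam ^+ size w * wquot M (size w)) <=
    C * 4 ^+ size w * 2^-1 ^+ size w * `|v| ^+ 2.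
Proof.
have [C [C0 HC]] := @cut_monom_bound R m s.
set t := size s.
have mu0 j : 0 <= wquot M j := ltW (wquot_gt0 regM j).
have lamk j : 0 <= lam ^+ j by rewrite exprn_ge0 ?ltW.
exists (C * (t`!%:R * 2 ^+ t) * (lam ^+ t.+2 * wquot M t.+2)); split.
  by do ! [apply: mulr_ge0 => //]; rewrite exprn_ge0.
move=> w v tw v0; set k := size w.
have mk := wquot_gt0 regM k; have mt := wquot_gt0 regM t.+2.
have [rv|rv] := ltP (wradius k) (enorm v).
  rewrite [rderives _ _ _](cut_monom_vanish s w (wradius_gt0 _) rv).
  by rewrite normr0 mul0r; do ! [apply: mulr_ge0 => //]; rewrite exprn_ge0 ?invr_ge0.
have nv : 0 < `|v| by rewrite normr_gt0.
have y0 : 0 <= lam * `|v| by rewrite mulr_ge0 ?ltW.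
have yk : lam * `|v| <= wratio M k.-1.
  apply: le_trans (_ : lam * wradius k <= _).
    by rewrite ler_pM2l//; exact: le_trans (norm_le_enorm v) rv.
  by rewrite mulrC /wradius divfK ?gt_eqF//; apply: wratio_ninc => //; exact: leq_pred.
have h := wquot_pow_le regM y0 tw (fun _ => yk).
have tk : (t <= k)%N by apply: leq_trans tw; rewrite leqW.
have h1 := HC (wradius k) w v (wradius_gt0 _) tk; rewrite -/k -/t in h1.
have h2 : `|v| ^+ (k - t) * (lam ^+ k * wquot M k) <=
    (lam ^+ t.+2 * wquot M t.+2) * `|v| ^+ 2.
  (* Multiplying by |v|^t turns the claim into the comparison [h] of full powers. *)
  rewrite -(ler_pM2l (exprn_gt0 t nv)) mulrA -exprD subnKC//.
  move: h; rewrite !exprMn -(addn2 t) !exprD => h.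
  by rewrite [leLHS](_ : _ = wquot M k * (lam ^+ k * `|v| ^+ k)) ?[leRHS](_ : _ = wquot M (t + 2)%N * (lam ^+ t * lam ^+ 2 * (`|v| ^+ t * `|v| ^+ 2))) ?exprD//; ring.
apply: le_trans (ler_wpM2r _ h1) _; first by rewrite mulr_ge0.
rewrite -[leLHS]mulrA; apply: le_trans (ler_wpM2l _ h2) _.
  by rewrite mulr_ge0 // exprn_ge0.
have h3 := expS_le R t k.
rewrite [leRHS](_ : _ = C * (t`!%:R * (2 ^+ t * 2 ^+ k)) *
    (lam ^+ t.+2 * wquot M t.+2 * `|v| ^+ 2)); last first.
  have -> : (4 : R) ^+ k = 2 ^+ k * 2 ^+ k by rewrite -exprMn; congr (_ ^+ _); lra.
  rewrite exprVn; have : (2 : R) ^+ k != 0 by rewrite expf_neq0.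
  by move=> h4; field.
apply: ler_wpM2r; first by do ! [apply: mulr_ge0 => //]; rewrite exprn_ge0.
by apply: ler_wpM2l => //; apply: le_trans h3 _; rewrite exprD [2 ^+ t * _]mulrC.
Qed.

End cut_series.

(** * Smoothness at the origin of series with controlled coefficients *)

Section cut_series_smooth.
Variables (R : realType) (m : nat) (M : nat -> R) (lam : R).
Hypotheses (regM : regular M) (lam0 : 0 < lam).
Implicit Types (v : 'rV[R]_m) (w : seq 'I_m) (c : seq 'I_m -> R).

Definition coef_bound c D := forall k,
  \sum_(w <- words m k) `|c w| <= D * ((lam / 4) ^+ k * wquot M k).

(** Words shorter than |s| + 2 are excluded, as their derivatives need not be O(|v|^2). The bound is
    uniform in the truncation K, hence valid although the number of active terms is unbounded as v
    tends to 0. *)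
Lemma cut_sum_bound s : exists C, 0 <= C /\ forall c D K v, 0 <= D ->
  coef_bound c D -> (forall w, (size w < (size s).+2)%N -> c w = 0) -> v != 0 ->
  \sum_(w <- words_lt m K) `|c w| * `|rderives s (cut_word M lam w) v|
    <= C * D * `|v| ^+ 2.
Proof.
have [C [C0 HC]] := cut_word_bound regM lam0 s; exists (C * 2).
split=> [|c D K v D0 Hc c0 v0]; first exact: mulr_ge0.
have v2 : 0 <= `|v| ^+ 2 by rewrite exprn_ge0.
rewrite big_words_lt.
apply: le_trans (_ : \sum_(k < K) (C * D * `|v| ^+ 2) * 2^-1 ^+ k <= _).
  apply: ler_sum => k _; have mk := wquot_gt0 regM k.
  have [ks|ks] := ltnP k (size s).+2.
    rewrite big_seq big1; last first.
      by move=> w /size_of_words wk; rewrite c0 ?wk// normr0 mul0r.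
    by rewrite !mulr_ge0// exprn_ge0// invr_ge0.
  pose y := lam ^+ k * wquot M k.
  have y0 : 0 < y by rewrite mulr_gt0// exprn_gt0.
  pose B := C * 4 ^+ k * 2^-1 ^+ k * `|v| ^+ 2 / y.
  have B0 : 0 <= B.
    by rewrite !mulr_ge0// ?exprn_ge0// ?invr_ge0// ltW.
  apply: le_trans (_ : \sum_(w <- words m k) `|c w| * B <= _).
    rewrite !big_seq; apply: ler_sum => w /size_of_words wk.
    apply: ler_wpM2l => //; rewrite ler_pdivlMr//.
    by have := HC w v; rewrite wk; apply.
  rewrite -mulr_suml; apply: le_trans (ler_wpM2r B0 (Hc k)) _.
  rewrite le_eqVlt; apply/predU1P; left; rewrite /B /y expr_div_n.
  have h1 : lam ^+ k != 0 by rewrite expf_neq0 ?gt_eqF.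
  have h2 : wquot M k != 0 by rewrite gt_eqF.
  have h3 : (4 : R) ^+ k != 0 by rewrite expf_neq0.
  by field; rewrite h1 h2 h3.
rewrite -mulr_sumr [leRHS](_ : _ = C * D * `|v| ^+ 2 * 2); last by ring.
by apply: ler_wpM2l; [rewrite !mulr_ge0|exact: sum_geom2].
Qed.

Lemma rderives_cut_series c s v : v != 0 ->
  rderives s (cut_series M lam c) v =
  \sum_(w <- words_lt m (level M lam v)) c w * rderives s (cut_word M lam w) v.
Proof.
move=> v0; set K := level M lam v.
have vK : v \in @level_set R m M lam K by apply/mem_set/level_wradius.
have oL := @open_level_set R m M lam regM lam0 K.
rewrite (rderives_eq s oL (cut_series_near regM lam0 c (k:=K)) vK).
rewrite (rderives_sum s _ _ oL _ vK)// => w n.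
by apply: Cn_sub (Cn_cut_word M lam n w).
Qed.

Lemma Cn_cut_series_tail n c D : 0 <= D -> coef_bound c D ->
  (forall w, (size w < n.+2)%N -> c w = 0) ->
  Cn n [set: 'rV[R]_m] (cut_series M lam c).
Proof.
move=> D0 Hc c0; apply: flat_Cn => [k||s sn].
- exact: Cn_cut_series_neq0.
- by rewrite /cut_series level0//= big_seq1 c0// mul0r.
have [C [C0 HC]] := cut_sum_bound s; exists (C * D) => v v0.
rewrite rderives_cut_series//; apply: le_trans (ler_norm_sum _ _ _) _.
under eq_bigr do rewrite normrM.
by apply: HC => // w ws; apply: c0; exact: leq_trans ws _.
Qed.

(** For each n separately, the words of length below n + 2 form a finite smooth sum and the others a
    flat tail. *)
Lemma Cn_cut_series n c D : 0 <= D -> coef_bound c D ->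
  Cn n [set: 'rV[R]_m] (cut_series M lam c).
Proof.
move=> D0 Hc; pose t w := if (size w < n.+2)%N then 0 else c w.
have tn : Cn n [set: 'rV[R]_m] (cut_series M lam t).
  apply: (Cn_cut_series_tail D0) => [k|w]; last by rewrite /t => ->.
  apply: le_trans (Hc k); apply: ler_sum => w _.
  by rewrite /t; case: ifP => //; rewrite normr0.
pose l w := if (size w < n.+2)%N then c w else 0.
have ln : Cn n [set: 'rV[R]_m]
    (fun v => \sum_(w <- words_lt m n.+2) l w * cut_word M lam w v).
  by apply: Cn_lincomb openT _ => w; exact: Cn_cut_word.
apply: (Cn_eq openT _ (CnD openT ln tn)) => v _.
pose K := maxn (level M lam v) n.+2.
rewrite !(cut_seriesE regM lam0 _ (leq_maxl _ n.+2)) -/K.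
rewrite -(words_lt_widen (k := K)) ?leq_maxr//; last first.
  by move=> w ws; rewrite /l ltnNge ws mul0r.
rewrite -big_split /=; apply: eq_bigr => w _; rewrite /l /t.
by case: ifP => _; rewrite mul0r ?addr0 ?add0r.
Qed.

End cut_series_smooth.

(** * The extension *)

Section modulus.
Variable R : realType.
Implicit Types a b : R[i].

Lemma cmodD a b : cmod (a + b) <= cmod a + cmod b.
Proof. exact: le_normcD. Qed.

Lemma cmodM a b : cmod (a * b) = cmod a * cmod b.
Proof. exact: ComplexField.Normc.normcM. Qed.

Lemma cmod_ge0 a : 0 <= cmod a.
Proof. by case: a => x y; exact: sqrtr_ge0. Qed.

Lemma cmod_real (r : R) : cmod r%:C%C = `|r|.
Proof. by rewrite /cmod /= expr0n /= addr0 sqrtr_sqr. Qed.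

Lemma cmod0 : cmod (0 : R[i]) = 0.
Proof. by rewrite (cmod_real 0) normr0. Qed.

Lemma cmod_realM (r : R) a : cmod (r%:C%C * a) = `|r| * cmod a.
Proof. by rewrite cmodM cmod_real. Qed.

Lemma Re_le_cmod a : `|complex.Re a| <= cmod a.
Proof.
by case: a => x y /=; rewrite -sqrtr_sqr /cmod/= ler_wsqrtr// lerDl exprn_even_ge0.
Qed.

Lemma Im_le_cmod a : `|complex.Im a| <= cmod a.
Proof.
by case: a => x y /=; rewrite -sqrtr_sqr /cmod/= ler_wsqrtr// lerDr exprn_even_ge0.
Qed.

Lemma cmod_sum (I : Type) (r : seq I) (F : I -> R[i]) :
  cmod (\sum_(i <- r) F i) <= \sum_(i <- r) cmod (F i).
Proof.
elim: r => [|i r IH]; first by rewrite !big_nil cmod0.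
by rewrite !big_cons; apply: le_trans (cmodD _ _) _; rewrite lerD2l.
Qed.

End modulus.

(** * Functions on a product of two spaces *)

Section product_domain.
Variables (R : realType) (E1 E2 : normedModType R).

Lemma continuous_fst : continuous (fst : E1 * E2 -> E1).
Proof. by move=> x; exact: cvg_fst. Qed.

Lemma continuous_snd : continuous (snd : E1 * E2 -> E2).
Proof. by move=> x; exact: cvg_snd. Qed.

Lemma open_prod (A : set E1) (B : set E2) : open A -> open B -> open (A `*` B).
Proof.
move=> oA oB; have -> : A `*` B = (fst @^-1` A) `&` (snd @^-1` B) by [].
by apply: openI; apply: open_comp => // x _; [exact: continuous_fst|exact: continuous_snd].
Qed.

Lemma smooth_on_fst (A : set E1) (B : set E2) g : smooth_on A g ->
  smooth_on (A `*` B) (fun p => g p.1).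
Proof.
move=> /smooth_onP[gR gI]; apply/smooth_onP; split=> n.
  apply: (Cn_sub _ (Cn_comp_linear (T := fst : {linear (E1 * E2)%type -> E1}) continuous_fst (gR n)).1).
  by move=> p [].
apply: (Cn_sub _ (Cn_comp_linear (T := fst : {linear (E1 * E2)%type -> E1}) continuous_fst (gI n)).1).
by move=> p [].
Qed.

Lemma smooth_on_snd (A : set E1) (B : set E2) g : smooth_on B g ->
  smooth_on (A `*` B) (fun p => g p.2).
Proof.
move=> /smooth_onP[gR gI]; apply/smooth_onP; split=> n.
  apply: (Cn_sub _ (Cn_comp_linear (T := snd : {linear (E1 * E2)%type -> E2}) continuous_snd (gR n)).1).
  by move=> p [].
apply: (Cn_sub _ (Cn_comp_linear (T := snd : {linear (E1 * E2)%type -> E2}) continuous_snd (gI n)).1).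
by move=> p [].
Qed.

Lemma smooth_on_local (E : normedModType R) (W : set E) (g : E -> R[i]) :
  (forall x, W x -> exists B : set E, B x /\ smooth_on B g) -> smooth_on W g.
Proof.
move=> H; apply/smooth_onP; split=> n; apply: Cn_local => x /H[B [Bx sB]];
  by exists B; split=> //; move/smooth_onP: sB => [].
Qed.

End product_domain.

Section word_sums.
Variables (R : realType) (m : nat).
Implicit Types (v : 'rV[R]_m) (a : seq 'I_m -> R[i]).

(* With [a w = X_w f] this reads [d/dv_j P_(k+1) = X_j P_k]. *)
Lemma derive_words_sum k a v j :
  (forall s t, perm_eq s t -> a s = a t) ->
  \sum_(w <- words m k.+1) ('D_(delta_mx 0 j) (monom w) v)%:C%C * a w =
  k.+1%:R * \sum_(w <- words m k) (monom w v)%:C%C * a (j :: w).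
Proof.
have Dcons i w : 'D_(delta_mx 0 j) (@monom R m (i :: w)) v =
    (j == i)%:R * monom w v + v 0 i * 'D_(delta_mx 0 j) (monom w) v.
  have -> : @monom R m (i :: w) = (fun v => v 0 i * monom w v).
    by apply/funext => x; rewrite monom_cons.
  have [dc Dc] := derivable_coord i v (delta_mx 0 j).
  rewrite (derive_mul dc (Cn_derivable (Cn_monom R 0 w) I)).2.
  by rewrite Dc mxE eqxx /= addrC eq_sym [X in X + _]mulrC.
elim: k a => [|k IH] a pa.
  rewrite big_wordsS mul1r /= big_seq1 (bigD1 j)//= big_seq1 big1 ?addr0.
    rewrite Dcons eqxx mul1r [X in _ + _ * X](_ : _ = 0) ?mulr0 ?addr0//.
    rewrite (_ : monom [::] = cst 1) ?derive_cst//.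
    by apply/funext => x; rewrite /monom big_nil.
  move=> i ij; rewrite big_seq1 Dcons eq_sym (negPf ij) mul0r add0r.
  rewrite (_ : monom [::] = cst 1) ?derive_cst ?mulr0 ?mul0r//.
  by apply/funext => x; rewrite /monom big_nil.
rewrite big_wordsS.
have -> : \sum_(i < m) \sum_(w <- words m k.+1)
      ('D_(delta_mx 0 j) (monom (i :: w)) v)%:C%C * a (i :: w) =
    \sum_(i < m) ((j == i)%:R%:C%C * \sum_(w <- words m k.+1) (monom w v)%:C%C * a (i :: w)
      + (v 0 i)%:C%C * \sum_(w <- words m k.+1)
          ('D_(delta_mx 0 j) (monom w) v)%:C%C * a (i :: w)).
  apply: eq_bigr => i _; rewrite !mulr_sumr -big_split /=.
  by apply: eq_bigr => w _; rewrite Dcons rmorphD !rmorphM /= mulrDl !mulrA.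
have delta (G : 'I_m -> R[i]) : \sum_(i < m) (j == i)%:R%:C%C * G i = G j.
  rewrite (bigD1 j)//= eqxx mul1r big1 ?addr0// => i ij.
  by rewrite eq_sym (negPf ij) mul0r.
rewrite big_split /= delta.
(* Differentiating the first letter yields one copy of the sum; the induction hypothesis on the
   remaining letters yields the other [k.+1]. *)
rewrite -[in RHS]natr1 mulrDl mul1r addrC; congr (_ + _).
have -> : \sum_(i < m) (v 0 i)%:C%C * \sum_(w <- words m k.+1)
          ('D_(delta_mx 0 j) (monom w) v)%:C%C * a (i :: w) =
    \sum_(i < m) (v 0 i)%:C%C * (k.+1%:R * \sum_(w <- words m k)
       (monom w v)%:C%C * a (i :: j :: w)).
  apply: eq_bigr => i _; rewrite (IH (fun w => a (i :: w)))//.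
  by move=> s t st; apply: pa; rewrite perm_cons.
rewrite big_wordsS mulr_sumr; apply: eq_bigr => i _.
rewrite mulrCA; congr (_ * _); rewrite mulr_sumr; apply: eq_bigr => w _.
rewrite monom_cons rmorphM mulrA; congr (_ * _); apply: pa.
(* Symmetry of [a] moves the letter j created by the derivative in front of i. *)
by rewrite -[i :: j :: w]/([:: i; j] ++ w) -[j :: i :: w]/([:: j; i] ++ w)
  perm_cat2r (perm_catC [:: i] [:: j]).
Qed.

End word_sums.

Section extension.
Variables (R : realType) (M : nat -> R) (d m : nat) (U V : set 'rV[R]_d)
  (X : 'I_m -> 'rV[R]_d -> 'rV[R[i]]_d) (f : 'rV[R]_d -> R[i]) (C lam : R).
Hypotheses (regM : regular M) (oU : open U)
  (sX : forall j, smooth_vfield U (X j)) (sf : smooth_on U f)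
  (oV : open V) (VU : V `<=` U) (C1 : 1 <= C)
  (HC : forall s u, V u ->
     cmod (vfield_word X s f u) <= C ^+ (size s).+1 * M (size s))
  (lamC : 4 * (C * m.+1%:R) <= lam).
Implicit Types (v : 'rV[R]_m) (u : 'rV[R]_d) (w s : seq 'I_m).

(** The factor [m.+1] instead of m keeps lam positive also when m = 0. *)
Lemma lam_ge4 : 4 <= lam.
Proof.
apply: le_trans lamC; rewrite -[leLHS]mulr1; apply: ler_wpM2l => //.
by rewrite -[leLHS]mulr1; apply: ler_pM => //; rewrite ler1n.
Qed.

Lemma lam_gt0 : 0 < lam.
Proof. by apply: lt_le_trans lam_ge4. Qed.

Lemma C_ge0 : 0 <= C. Proof. exact: le_trans ler01 C1. Qed.

Lemma Cm_pow k : (C * m%:R) ^+ k <= (lam / 4) ^+ k.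
Proof.
apply: lerXn2r; rewrite ?nnegrE ?mulr_ge0 ?C_ge0// ?invr_ge0 ?(ltW lam_gt0)//.
rewrite ler_pdivlMr// mulrC; apply: le_trans lamC.
by apply: ler_wpM2l => //; rewrite (ler_wpM2l C_ge0)// ler_nat.
Qed.

Definition wcut w v : R := (size w)`!%:R^-1 * cut_word M lam w v.

(** Grouped by length k, the words give the cutoff at radius r_k / lam times P_k, since (v . X)^k f
    is the sum of [monom w v] X_w f over words of length k. *)
Definition extension (p : 'rV[R]_d * 'rV[R]_m) : R[i] :=
  \sum_(w <- words_lt m (level M lam p.2))
    (wcut w p.2)%:C%C * vfield_word X w f p.1.

Lemma extensionE u v k : (level M lam v <= k)%N -> extension (u, v) =
  \sum_(w <- words_lt m k) (wcut w v)%:C%C * vfield_word X w f u.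
Proof.
move=> lk; rewrite (words_lt_widen lk)// => w /(cut_word_eq0 regM lam_gt0) h.
by rewrite /wcut h mulr0 mul0r.
Qed.

Lemma cut_word_nil v : cut_word M lam [::] v = ebump ((wradius M lam 0)^-1 *: v).
Proof. by rewrite /cut_word /cut_monom /monom big_nil mul1r. Qed.

Lemma extension0 u : extension (u, 0) = f u.
Proof.
rewrite /extension (level0 m regM lam_gt0) /= big_seq1 /wcut cut_word_nil scaler0.
by rewrite ebump_eq1 ?enorm0 ?invr_ge0//= fact0 invr1 mulr1 mul1r.
Qed.

Lemma smooth_words_sum k : smooth_on (U `*` [set: 'rV[R]_m])
  (fun p => \sum_(w <- words_lt m k) (wcut w p.2)%:C%C * vfield_word X w f p.1).
Proof.
have oP := open_prod oU (@openT 'rV[R]_m).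
apply: (smooth_on_sum _ oP) => w; apply: (smooth_onM oP).
  have h : smooth_on [set: 'rV[R]_m] (fun v => (wcut w v)%:C%C).
    by apply: smooth_on_real => n; apply: CnZ openT _; exact: Cn_cut_word.
  exact: smooth_on_snd h.
apply: smooth_on_fst; exact: smooth_vfield_word.
Qed.

Lemma smooth_extension : smooth_on (V `*` [set v | v != 0]) extension.
Proof.
apply: smooth_on_local => -[u v] [/= Vu v0].
pose k := level M lam v; exists (V `*` @level_set R m M lam k).
split; first by split=> //=; exact: (level_wradius regM lam_gt0).
have oP := open_prod oV (@open_level_set R m M lam regM lam_gt0 k).
apply: (smooth_on_eq oP _ (smooth_on_sub _ (smooth_words_sum k))); last first.
  by move=> [u' v'] [/= /VU Uu' _].
move=> [u' v'] /set_mem[/= _ v'k]; by rewrite (extensionE u' (level_le v'k)).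
Qed.

(** A prefix [g] coming from X^gamma replaces M_k by M_{k+|g|}; the comparison of the two is left as
    a hypothesis, to be discharged in two ways according to the growth of M. *)
Lemma coef_boundP g D u (c : seq 'I_m -> R) : V u ->
  (forall k, C ^+ (k + size g).+1 * M (k + size g)%N * m%:R ^+ k / k`!%:R <=
     D * ((lam / 4) ^+ k * wquot M k)) ->
  (forall w, `|c w| <= (size w)`!%:R^-1 * cmod (vfield_word X (g ++ w) f u)) ->
  coef_bound M lam c D.
Proof.
move=> Vu HD Hc k; apply: le_trans (HD k).
apply: le_trans (_ : \sum_(w <- words m k)
   (k`!%:R^-1 * (C ^+ (k + size g).+1 * M (k + size g)%N)) <= _).
  rewrite !big_seq; apply: ler_sum => w /size_of_words wk.
  apply: le_trans (Hc w) _; rewrite wk; apply: ler_wpM2l; first by rewrite invr_ge0.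
  by apply: le_trans (HC _ Vu) _; rewrite size_cat wk addnC.
rewrite big_const_seq count_predT size_words iter_addr addr0 -[leLHS]mulr_natr natrX.
by rewrite le_eqVlt; apply/predU1P; left; ring.
Qed.

Lemma coef_bound0 u (c : seq 'I_m -> R) : V u ->
  (forall w, `|c w| <= (size w)`!%:R^-1 * cmod (vfield_word X w f u)) ->
  coef_bound M lam c C.
Proof.
move=> Vu; apply: (coef_boundP (g := [::]) Vu) => k /=.
rewrite addn0 (wquotE M k).
rewrite [leLHS](_ : _ = C * ((C * m%:R) ^+ k * wquot M k)).
  apply: (ler_wpM2l C_ge0); apply: ler_wpM2r (Cm_pow k).
  exact/ltW/wquot_gt0.
have h : (k`!%:R : R) != 0 by rewrite pnatr_eq0 -lt0n fact_gt0.
by rewrite exprMn exprS; field.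
Qed.

(** The truncation [level] depends on v alone, so for fixed v the function of u is a single finite
    sum and X^gamma passes inside. At fixed u the real and imaginary parts are then instances of
    [cut_series]. *)
Lemma smooth_in_v_extension gamma D : 0 <= D ->
  (forall k, C ^+ (k + mdeg gamma).+1 * M (k + mdeg gamma)%N * m%:R ^+ k / k`!%:R
     <= D * ((lam / 4) ^+ k * wquot M k)) ->
  smooth_in_v X V extension gamma.
Proof.
move=> D0; rewrite -size_word_of => HD u Vu; set g := word_of gamma.
have E v : vfield_pow X gamma (fun u' => extension (u', v)) u =
    \sum_(w <- words_lt m (level M lam v))
       (wcut w v)%:C%C * vfield_word X (g ++ w) f u.
  rewrite vfield_powE -/g /extension /=.
  rewrite (vfield_word_sum oU sX g _ (fun w => wcut w v) oV VU _ (mem_set Vu)).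
    by apply: eq_bigr => w _; rewrite vfield_word_cat.
  by move=> w; exact: smooth_vfield_word.
apply/smooth_onP; split=> n.
  apply: (Cn_eq openT _ (Cn_cut_series regM lam_gt0 n
    (c := fun w => (size w)`!%:R^-1 * complex.Re (vfield_word X (g ++ w) f u)) D0 _)).
    move=> v _; rewrite E /cut_series.
    rewrite cRe_realsum; apply: eq_bigr => w _; rewrite /wcut; ring.
  apply: (coef_boundP Vu HD) => w.
  rewrite normrM ger0_norm ?invr_ge0//; apply: ler_wpM2l; first by rewrite invr_ge0.
  exact: Re_le_cmod.
apply: (Cn_eq openT _ (Cn_cut_series regM lam_gt0 n
  (c := fun w => (size w)`!%:R^-1 * complex.Im (vfield_word X (g ++ w) f u)) D0 _)).
  move=> v _; rewrite E /cut_series.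
  rewrite cIm_realsum; apply: eq_bigr => w _; rewrite /wcut; ring.
apply: (coef_boundP Vu HD) => w.
rewrite normrM ger0_norm ?invr_ge0//; apply: ler_wpM2l; first by rewrite invr_ge0.
exact: Im_le_cmod.
Qed.

(** Beyond the words of length 0 and 1 the series is O(|v|^2) uniformly in u; this gives joint
    continuity at (u, 0). *)
Lemma extension_tail : exists K0, 0 <= K0 /\ forall u v, V u ->
  cmod (extension (u, v) -
    \sum_(w <- words_lt m 2) (wcut w v)%:C%C * vfield_word X w f u) <=
  K0 * `|v| ^+ 2.
Proof.
have [K1 [K10 HK]] := cut_sum_bound regM lam_gt0 ([::] : seq 'rV[R]_m).
exists (K1 * C); split=> [|u v Vu]; first by rewrite mulr_ge0// C_ge0.
have [->|v0] := eqVneq v 0.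
  rewrite (extensionE u (k := 2%N)) ?(level0 m regM lam_gt0)//.
  by rewrite subrr cmod0 normr0 expr2 !mulr0.
pose K := maxn (level M lam v) 2.
rewrite (extensionE u (leq_maxl _ 2 : (level M lam v <= K)%N)).
pose t w := if (size w < 2)%N then 0 else (size w)`!%:R^-1 * cmod (vfield_word X w f u).
have t0 w : 0 <= t w by rewrite /t; case: ifP => // _; rewrite mulr_ge0 ?invr_ge0 ?cmod_ge0.
have tb : coef_bound M lam t C.
  apply: (coef_bound0 Vu) => w; rewrite ger0_norm// /t; case: ifP => // _.
  by rewrite mulr_ge0 ?invr_ge0 ?cmod_ge0.
have ts w : (size w < 2)%N -> t w = 0 by rewrite /t => ->.
apply: le_trans (HK t C K v C_ge0 tb ts v0).
pose T w := (wcut w v)%:C%C * vfield_word X w f u.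
pose T1 w := if (size w < 2)%N then T w else 0.
have -> : \sum_(w <- words_lt m 2) (wcut w v)%:C%C * vfield_word X w f u =
    \sum_(w <- words_lt m K) T1 w.
  rewrite (words_lt_widen (leq_maxr _ 2 : (2 <= K)%N)); last first.
    by move=> w ws; rewrite /T1 ltnNge ws.
  by rewrite !big_seq; apply: eq_bigr => w /size_of_words_lt ws; rewrite /T1 ws.
rewrite -sumrB; apply: le_trans (cmod_sum _ _) _; apply: ler_sum => w _.
rewrite /T1 /t /=; case: ifP => _; first by rewrite subrr cmod0 normr0 mul0r.
have k0 : 0 <= ((size w)`!%:R : R)^-1 by rewrite invr_ge0.
rewrite subr0 cmod_realM /wcut normrM mulrAC (ger0_norm k0).
by rewrite (ger0_norm (mulr_ge0 k0 (cmod_ge0 _))).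
Qed.

Lemma continuous_tail (h t : 'rV[R]_d * 'rV[R]_m -> R) K0 u : V u ->
  {for (u, 0), continuous t} -> 0 <= K0 ->
  (forall u' v', V u' -> `|h (u', v') - t (u', v')| <= K0 * `|v'| ^+ 2) ->
  {for (u, 0), continuous h}.
Proof.
move=> Vu ct K00 H.
have e0 : (h - t) (u, 0) = 0.
  by apply/eqP; rewrite -normr_le0; apply: le_trans (H u 0 Vu) _; rewrite normr0 expr2 !mulr0.
have -> : h = t + (h - t) by rewrite addrC subrK.
apply: cvgD; first exact: ct.
rewrite e0; apply/cvgr0Pnorm_le => e ep.
have K1 : 0 < K0 + 1 by rewrite ltr_wpDl.
pose r := Num.min 1 (e / (K0 + 1)).
have r0 : 0 < r by rewrite lt_min ltr01 divr_gt0.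
have h1 : \forall p \near (u, 0 : 'rV[R]_m), V p.1.
  apply: (@continuous_fst R 'rV[R]_d 'rV[R]_m (u, 0) V).
  exact: open_nbhs_nbhs.
have h2 : \forall p \near (u, 0 : 'rV[R]_m), `|p.2| < r.
  apply: (@continuous_snd R 'rV[R]_d 'rV[R]_m (u, 0) [set v | `|v| < r]).
  have : \forall v \near (0 : 'rV[R]_m), `|v| < r by exact: nbhs0_lt.
  by [].
apply: filterS2 h1 h2 => -[u' v'] /= Vu' vr.
apply: le_trans (H u' v' Vu') _.
move: vr; rewrite lt_min => /andP[v1 v2].
apply: le_trans (_ : K0 * `|v'| <= _).
  by rewrite expr2 mulrA ler_piMr ?mulr_ge0// ltW.
move: v2; rewrite ltr_pdivlMr// mulrC => /ltW; apply: le_trans.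
by apply: ler_wpM2r => //; rewrite lerDl.
Qed.

Lemma continuous_extension : ccontinuous_on (V `*` [set: 'rV[R]_m]) extension.
Proof.
move=> [u v] [/= Vu _]; have [->|v0] := eqVneq v 0; last first.
  by have [c _] := smooth_extension [::]; exact: c.
have [K0 [K00 HK]] := extension_tail.
have [c _] := smooth_words_sum 2 [::].
have [cR cI] := c (u, 0) (conj (VU Vu) I).
split.
  apply: (continuous_tail Vu cR K00) => u' v' Vu'; apply: le_trans (HK u' v' Vu').
  apply: le_trans (Re_le_cmod _); rewrite cReD le_eqVlt; apply/predU1P; left.
  by rewrite /=; case: (\sum_(w <- _) _).
apply: (continuous_tail Vu cI K00) => u' v' Vu'; apply: le_trans (HK u' v' Vu').
apply: le_trans (Im_le_cmod _); rewrite cImD le_eqVlt; apply/predU1P; left.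
by rewrite /=; case: (\sum_(w <- _) _).
Qed.

(** * Taylor terms, their cutoffs, and the estimate of L_j F *)

Definition wcutoff k v : R := ebump ((wradius M lam k)^-1 *: v).

(* [taylor k], [taylor_d j k] and [dtaylor j k] are [P_k], [X_j P_k] and
   [d/dv_j P_k]. *)
Definition taylor k u v : R[i] :=
  \sum_(w <- words m k) (k`!%:R^-1 * monom w v)%:C%C * vfield_word X w f u.

Definition taylor_d j k u v : R[i] :=
  \sum_(w <- words m k) (k`!%:R^-1 * monom w v)%:C%C * vfield_word X (j :: w) f u.

Hypothesis commX : forall i j, commuting_on U (X i) (X j).

Lemma wcutoff_eq0 k v : wradius M lam k <= enorm v -> wcutoff k v = 0.
Proof.
move=> h; apply: ebump_eq0; have r0 := wradius_gt0 regM lam_gt0 k.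
by rewrite enormZ gtr0_norm ?invr_gt0// ler_pdivlMl// mulr1.
Qed.

Lemma wcutoff_eq1 k v : enorm v <= wradius M lam k / 2 -> wcutoff k v = 1.
Proof.
move=> h; apply: ebump_eq1; have r0 := wradius_gt0 regM lam_gt0 k.
by rewrite enormZ gtr0_norm ?invr_gt0// ler_pdivrMl.
Qed.

Lemma Cn_wcutoff n k : Cn n [set: 'rV[R]_m] (wcutoff k).
Proof. by apply: Cn_scale; exact: Cn_ebump. Qed.

Lemma wcut_sum_d j k u v :
  \sum_(w <- words m k) (wcut w v)%:C%C * vfield_word X (j :: w) f u =
  (wcutoff k v)%:C%C * taylor_d j k u v.
Proof.
rewrite mulr_sumr !big_seq; apply: eq_bigr => w /size_of_words wk.
rewrite mulrA -rmorphM /= /wcut /cut_word /cut_monom wk -/(wcutoff k v).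
by congr (_%:C%C * _); ring.
Qed.

Definition dtaylor j k u v : R[i] :=
  \sum_(w <- words m k)
    (k`!%:R^-1 * 'D_(delta_mx 0 j) (monom w) v)%:C%C * vfield_word X w f u.

Lemma dtaylor0 j u v : dtaylor j 0 u v = 0.
Proof.
rewrite /dtaylor /= big_seq1 (_ : monom [::] = cst 1) ?derive_cst ?mulr0 ?mul0r//.
by apply/funext => x; rewrite /monom big_nil.
Qed.

Lemma dtaylorS j k u v : V u -> dtaylor j k.+1 u v = taylor_d j k u v.
Proof.
move=> Vu; have pa s t : perm_eq s t -> vfield_word X s f u = vfield_word X t f u.
  by move=> st; apply: (perm_vfield_word oU sX commX sf st); apply/mem_set/VU.
have h := derive_words_sum k v j pa.
have e K (c : seq 'I_m -> R) (z : R) : \sum_(w <- words m K) (z * c w)%:C%C * vfield_word X w f u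
    = z%:C%C * \sum_(w <- words m K) (c w)%:C%C * vfield_word X w f u.
  by rewrite mulr_sumr; apply: eq_bigr => w _; rewrite rmorphM mulrA.
rewrite /dtaylor e h mulrA /taylor_d mulr_sumr.
apply: eq_bigr => w _; rewrite mulrA; congr (_ * _).
have -> : (k.+1%:R : R[i]) = (k.+1%:R : R)%:C%C by rewrite rmorph_nat.
rewrite -!rmorphM /= factS natrM invfM; congr (_%:C%C).
have k0 : (k.+1%:R : R) != 0 by rewrite pnatr_eq0.
by congr (_ * _); rewrite mulrAC mulVf// mul1r.
Qed.

Lemma derive_cut_sum j k u v :
  \sum_(w <- words m k)
    ((size w)`!%:R^-1 * 'D_(delta_mx 0 j) (cut_word M lam w) v)%:C%C * vfield_word X w f u =
  ('D_(delta_mx 0 j) (wcutoff k) v)%:C%C * taylor k u v + (wcutoff k v)%:C%C * dtaylor j k u v.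
Proof.
rewrite !mulr_sumr -big_split /= !big_seq; apply: eq_bigr => w /size_of_words wk.
have -> : cut_word M lam w = (fun y => monom w y * wcutoff k y).
  by apply/funext => y; rewrite /cut_word /cut_monom wk.
rewrite (derive_mul (Cn_derivable (Cn_monom R 0 w) I) (Cn_derivable (Cn_wcutoff 0 k) I)).2.
rewrite !mulrA -!rmorphM -mulrDl -rmorphD wk; congr (_%:C%C * _) => /=.
by ring.
Qed.

(** In this form the first summand lives only where r_k / 2 <= lam |v| <= r_k, and the second only
    where r_{k+1} / 2 <= lam |v| <= r_k. *)
Lemma Lfield_extension j u v : V u -> v != 0 ->
  Lfield X j extension u v =
  \sum_(k < level M lam v)
    (('D_(delta_mx 0 j) (wcutoff k) v)%:C%C * taylor k u v
     + (wcutoff k.+1 v - wcutoff k v)%:C%C * taylor_d j k u v).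
Proof.
move=> Vu v0; set K := level M lam v; rewrite /Lfield.
have oL := @open_level_set R m M lam regM lam_gt0 K.
have vK : @level_set R m M lam K v := level_wradius regM lam_gt0 v0.
pose G (v' : 'rV[R]_m) := \sum_(w <- words_lt m K) (wcut w v')%:C%C * vfield_word X w f u.
have GE : {in @level_set R m M lam K, (fun v' => extension (u, v')) =1 G}.
  by move=> v' /set_mem /level_le h; rewrite (extensionE u h).
rewrite (near_cderive (delta_mx 0 j) (open_near_eq oL GE vK)) /G.
have db w : derivable (wcut w) v (delta_mx 0 j).
  by apply: derivableZ; exact: Cn_derivable (Cn_cut_word M lam 0 w) I.
rewrite (cderive_real_comb _ _ db).
rewrite /extension /= -/K.
rewrite (vfield_act_sum _ _ (fun w => wcut w v) (VU Vu)); last first.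
  by move=> w; exact: smooth_vfield_word.
rewrite !big_words_lt.
have -> : \sum_(k < K) \sum_(w <- words m k)
     ('D_(delta_mx 0 j) (wcut w) v)%:C%C * vfield_word X w f u =
   \sum_(k < K) (('D_(delta_mx 0 j) (wcutoff k) v)%:C%C * taylor k u v)
   + \sum_(k < K) (wcutoff k v)%:C%C * dtaylor j k u v.
  rewrite -big_split /=; apply: eq_bigr => k _; rewrite -derive_cut_sum.
  apply: eq_bigr => w _.
  by rewrite (derive_scalel _ (Cn_derivable (Cn_cut_word M lam 0 w) I)).2.
have -> : \sum_(k < K) \sum_(w <- words m k)
     (wcut w v)%:C%C * vfield_act (X j) (vfield_word X w f) u =
   \sum_(k < K) (wcutoff k v)%:C%C * taylor_d j k u v.
  by apply: eq_bigr => k _; rewrite -wcut_sum_d.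
(* The index shift costs no boundary terms: the term of index 0 is constant in v before cutting, and
   the cutoff of index K vanishes at v. *)
have -> : \sum_(k < K) (wcutoff k v)%:C%C * dtaylor j k u v =
    \sum_(k < K) (wcutoff k.+1 v)%:C%C * taylor_d j k u v.
  pose S k := (wcutoff k v)%:C%C * dtaylor j k u v.
  have SK : S K = 0 by rewrite /S wcutoff_eq0 ?mul0r// ltW.
  have S0 : S 0%N = 0 by rewrite /S dtaylor0 mulr0.
  have H1 : \sum_(k < K.+1) S k = \sum_(k < K) S k + S K by rewrite big_ord_recr.
  have H2 : \sum_(k < K.+1) S k = S 0%N + \sum_(k < K) S k.+1 by rewrite big_ord_recl.
  move: H1; rewrite H2 SK addr0 S0 add0r => <-.
  by apply: eq_bigr => k _; rewrite /S dtaylorS.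
rewrite -addrA -sumrB -big_split /=; apply: eq_bigr => k _.
by rewrite rmorphB mulrBl.
Qed.

Lemma taylor_le k u v : V u ->
  cmod (taylor k u v) <= C * ((lam / 4) ^+ k * wquot M k) * enorm v ^+ k.
Proof.
move=> Vu; pose c w := (size w)`!%:R^-1 * cmod (vfield_word X w f u).
have c0 w : 0 <= c w by rewrite mulr_ge0 ?invr_ge0 ?cmod_ge0.
have cb : coef_bound M lam c C by apply: (coef_bound0 Vu) => w; rewrite ger0_norm.
have xk : 0 <= enorm v ^+ k by rewrite exprn_ge0 ?enorm_ge0.
apply: le_trans (cmod_sum _ _) _; apply: le_trans (ler_wpM2r xk (cb k)).
rewrite mulr_suml !big_seq; apply: ler_sum => w /size_of_words wk.
rewrite (ger0_norm (c0 w)) /c wk cmod_realM normrM ger0_norm ?invr_ge0//.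
rewrite -!mulrA; apply: ler_wpM2l; first by rewrite invr_ge0.
rewrite mulrC; apply: ler_wpM2l; first exact: cmod_ge0.
by rewrite -wk; apply: monom_le; exact: norm_le_enorm.
Qed.

(** The extra field raises M_k to M_{k+1}, and M_{k+1} / k! = (k+1) m_{k+1}. *)
Lemma taylor_d_le j k u v : V u ->
  cmod (taylor_d j k u v) <=
  C ^+ 2 * ((lam / 4) ^+ k * (k.+1%:R * wquot M k.+1)) * enorm v ^+ k.
Proof.
move=> Vu; have xk : 0 <= enorm v ^+ k by rewrite exprn_ge0 ?enorm_ge0.
apply: le_trans (cmod_sum _ _) _.
apply: le_trans (_ : \sum_(w <- words m k)
   (k`!%:R^-1 * (C ^+ k.+2 * M k.+1)) * enorm v ^+ k <= _).
  rewrite !big_seq; apply: ler_sum => w /size_of_words wk.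
  rewrite cmod_realM normrM ger0_norm ?invr_ge0// -[leLHS]mulrA -[leRHS]mulrA.
  apply: ler_wpM2l; first by rewrite invr_ge0.
  rewrite mulrC; apply: ler_pM => //; first exact: cmod_ge0.
    by apply: le_trans (HC _ Vu) _; rewrite /= wk.
  by rewrite -wk; apply: monom_le; exact: norm_le_enorm.
rewrite -mulr_suml; apply: ler_wpM2r => //.
rewrite big_const_seq count_predT size_words iter_addr addr0 -[leLHS]mulr_natr natrX.
rewrite [leLHS](_ : _ = C ^+ 2 * ((C * m%:R) ^+ k * (k.+1%:R * wquot M k.+1))).
  apply: ler_wpM2l; first by rewrite exprn_ge0// C_ge0.
  by apply: ler_wpM2r (Cm_pow k); rewrite mulr_ge0// ltW// wquot_gt0.
have h : (k`!%:R : R) != 0 by rewrite pnatr_eq0 -lt0n fact_gt0.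
by rewrite (wquotE M k.+1) factS natrM exprMn !exprS; field.
Qed.

Lemma wcutoff_derive_eq0 j k v : enorm v < wradius M lam k / 2 ->
  'D_(delta_mx 0 j) (wcutoff k) v = 0.
Proof.
move=> h; have r0 := wradius_gt0 regM lam_gt0 k.
have oW : open [set v : 'rV[R]_m | enorm v < wradius M lam k / 2].
  by apply: open_enorm_lt; rewrite divr_ge0// ltW.
have E : {in [set v : 'rV[R]_m | enorm v < wradius M lam k / 2], wcutoff k =1 cst 1}.
  by move=> x /set_mem /= xr; rewrite wcutoff_eq1// ltW.
by rewrite (near_eq_derive _ (open_near_eq oW E h)) derive_cst.
Qed.

Lemma wcutoff_derive_eq0r j k v : wradius M lam k < enorm v ->
  'D_(delta_mx 0 j) (wcutoff k) v = 0.
Proof.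
move=> rv; have r0 := wradius_gt0 regM lam_gt0 k.
have := @rderives_vanish R m _ (wcutoff k) [:: delta_mx 0 j] v (open_enorm_gt (ltW r0)).
by move=> /(_ _ rv) /= -> // x /= rx; rewrite wcutoff_eq0// ltW.
Qed.

(** The dilation costs 1/r, but |v| <= r on the support; so the cost is at most a constant times
    1/|v|, uniformly in k. *)
Lemma wcutoff_derive_bound : exists B, 0 <= B /\ forall j k v,
  `|'D_(delta_mx 0 j) (wcutoff k) v| * enorm v <= B.
Proof.
have H j := cutlike_bounded (cutlike_derive (delta_mx 0 j) (@cutlike_bump R m)).
have [B HB] := boolp.choice H; exists (\sum_j B j).
split=> [|j k v]; first by apply: sumr_ge0 => j _; exact: (HB j).1.
have r0 := wradius_gt0 regM lam_gt0 k; set r := wradius M lam k in r0 *.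
have [rv|rv] := ltP r (enorm v).
  rewrite wcutoff_derive_eq0r// normr0 mul0r sumr_ge0// => i _; exact: (HB i).1.
have de (h x : 'rV[R]_m) : derivable (@ebump R m) x h by exact: Cn_derivable (Cn_ebump R m 0) I.
rewrite (derive_scale (@ebump R m)) derive_dirZ// normrM gtr0_norm ?invr_gt0//.
rewrite mulrAC; apply: le_trans (_ : 1 * B j <= _).
  apply: ler_pM => //; first by rewrite mulr_ge0 ?invr_ge0 ?enorm_ge0// ltW.
    by rewrite ler_pdivrMl// mulr1.
  exact: (HB j).2.
rewrite mul1r (bigD1 j)//= lerDl sumr_ge0// => i _; exact: (HB i).1.
Qed.

Lemma wquot_pow_active k l v : wradius M lam k / 2 <= enorm v ->
  ((0 < k)%N -> enorm v <= wradius M lam k.-1) ->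
  wquot M k * (lam * enorm v) ^+ k <= wquot M l * (2 * lam * enorm v) ^+ l.
Proof.
move=> h1 h2; have l0 := lam_gt0; rewrite -mulrA; apply: wquot_pow_inf => //.
- by rewrite mulr_ge0 ?enorm_ge0// ltW.
- by move=> /h2; rewrite /wradius ler_pdivlMr// mulrC.
- by move: h1; rewrite /wradius ler_pdivrMr// ler_pdivrMr// => h; lra.
Qed.

Lemma lam4_pow k x y : y * (lam * x) ^+ k * 4^-1 ^+ k = (lam / 4) ^+ k * y * x ^+ k.
Proof. by rewrite !exprMn; ring. Qed.

Lemma pow4V_le k : (4^-1 : R) ^+ k <= 2^-1 ^+ k.
Proof. by apply: lerXn2r; rewrite ?nnegrE; lra. Qed.

(** Both sides carry a factor |v| clearing the 1/|v| of the cutoff derivative. The index l is free,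
    as k is tied to the size of v. *)
Lemma Lfield_term1 B l j k u v : V u ->
  `|'D_(delta_mx 0 j) (wcutoff k) v| * enorm v <= B ->
  cmod (('D_(delta_mx 0 j) (wcutoff k) v)%:C%C * taylor k u v) * enorm v <=
  B * C * (wquot M l * (2 * lam * enorm v) ^+ l) * 2^-1 ^+ k.
Proof.
move=> Vu HB; have x0 := enorm_ge0 v; have l0 := ltW lam_gt0.
have B0 : 0 <= B by apply: le_trans HB; rewrite mulr_ge0.
have C0 := C_ge0; have m0 := ltW (wquot_gt0 regM l).
have T0 : 0 <= B * C * (wquot M l * (2 * lam * enorm v) ^+ l) * 2^-1 ^+ k.
  by rewrite !(mulr_ge0, exprn_ge0, invr_ge0)// (regular_M_ge0 regM).
have [h1|h1] := ltP (enorm v) (wradius M lam k / 2).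
  by rewrite wcutoff_derive_eq0// mul0r cmod0 mul0r.
have [h2|h2] := ltP (wradius M lam k) (enorm v).
  by rewrite wcutoff_derive_eq0r// mul0r cmod0 mul0r.
have h3 : (0 < k)%N -> enorm v <= wradius M lam k.-1.
  by move=> _; apply: le_trans h2 _; apply: wradius_ninc regM lam_gt0 _ _ (leq_pred k).
have h := wquot_pow_active l h1 h3.
rewrite cmod_realM mulrAC -[leRHS]mulrA -[leRHS]mulrA.
apply: ler_pM => //; rewrite ?mulr_ge0 ?cmod_ge0//.
apply: le_trans (taylor_le k v Vu) _; rewrite -mulrA -lam4_pow.
apply: ler_wpM2l => //; apply: ler_pM => //; rewrite ?exprn_ge0 ?invr_ge0//.
  by rewrite !(mulr_ge0, exprn_ge0, invr_ge0)// (regular_M_ge0 regM).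
exact: pow4V_le.
Qed.

(** The comparison is made at index k + 1: multiplication by |v| completes |v|^k to |v|^(k+1), at
    the price of a harmless 1/lam. *)
Lemma Lfield_term2 l j k u v : V u ->
  cmod ((wcutoff k.+1 v - wcutoff k v)%:C%C * taylor_d j k u v) * enorm v <=
  C ^+ 2 * 2 * (wquot M l * (2 * lam * enorm v) ^+ l) * 2^-1 ^+ k.
Proof.
move=> Vu; have x0 := enorm_ge0 v; have l0 := ltW lam_gt0.
have C0 := C_ge0; have m0 := ltW (wquot_gt0 regM l).
have T0 : 0 <= C ^+ 2 * 2 * (wquot M l * (2 * lam * enorm v) ^+ l) * 2^-1 ^+ k.
  by rewrite !(mulr_ge0, exprn_ge0, invr_ge0)// (regular_M_ge0 regM).
have rk := wradius_ninc regM lam_gt0 (leqnSn k).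
have [h1|h1] := ltP (enorm v) (wradius M lam k.+1 / 2).
  rewrite !wcutoff_eq1 ?subrr ?mul0r ?cmod0 ?mul0r// ltW//.
  by apply: lt_le_trans h1 _; rewrite ler_pM2r.
have [h2|h2] := ltP (wradius M lam k) (enorm v).
  rewrite !wcutoff_eq0 ?subrr ?mul0r ?cmod0 ?mul0r// ltW//.
  exact: le_lt_trans rk h2.
have h := wquot_pow_active l h1 (fun _ => h2).
have c1 : `|wcutoff k.+1 v - wcutoff k v| <= 1.
  have := cutoff_ge0 (sqnorm ((wradius M lam k)^-1 *: v)).
  have := cutoff_le1 (sqnorm ((wradius M lam k)^-1 *: v)).
  have := cutoff_ge0 (sqnorm ((wradius M lam k.+1)^-1 *: v)).
  have := cutoff_le1 (sqnorm ((wradius M lam k.+1)^-1 *: v)).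
  rewrite /wcutoff /ebump ler_norml => *; apply/andP; split; lra.
rewrite cmod_realM -[leLHS]mulrA; apply: le_trans (_ : 1 * (cmod (taylor_d j k u v) * enorm v) <= _).
  by apply: (ler_wpM2r _ c1); rewrite mulr_ge0 ?cmod_ge0.
rewrite mul1r; apply: le_trans (ler_wpM2r x0 (taylor_d_le j k v Vu)) _.
have hl : (wquot M k.+1 * (lam * enorm v) ^+ k.+1) * lam^-1 <=
    wquot M l * (2 * lam * enorm v) ^+ l.
  rewrite ler_pdivrMr ?lam_gt0//; apply: le_trans h _; rewrite ler_peMr//.
    by rewrite !(mulr_ge0, exprn_ge0, invr_ge0)// (regular_M_ge0 regM).
  by apply: le_trans lam_ge4; lra.
(* Here k + 1 <= 2^(k+1) consumes one of the two factors 2^-k. *)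
have hk : (k.+1%:R : R) * 4^-1 ^+ k <= 2 * 2^-1 ^+ k.
  have := expS_le R 1 k; rewrite expr1 fact_prod big_nat1 mul1r addn1 => hh.
  apply: le_trans (ler_wpM2r _ hh) _; first by rewrite exprn_ge0// invr_ge0.
  rewrite exprS -mulrA ler_pM2l// -exprMn le_eqVlt; apply/predU1P; left.
  by congr (_ ^+ _); lra.
have lamn0 : lam != 0 by rewrite gt_eqF// lam_gt0.
rewrite [leLHS](_ : _ = C ^+ 2 * ((k.+1%:R * 4^-1 ^+ k) *
   ((wquot M k.+1 * (lam * enorm v) ^+ k.+1) * lam^-1))); last first.
  by rewrite !exprMn !exprS; field.
rewrite [leRHS](_ : _ = C ^+ 2 * ((2 * 2^-1 ^+ k) * (wquot M l * (2 * lam * enorm v) ^+ l))); last by ring.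
apply: ler_wpM2l; first by rewrite exprn_ge0.
apply: ler_pM => //.
by rewrite !(mulr_ge0, exprn_ge0, invr_ge0)// (regular_M_ge0 regM).
Qed.

Lemma Lfield_bound : exists Q, 0 < Q /\ forall u v k j, V u -> 0 < enorm v ->
  cmod (Lfield X j extension u v) <= Q ^+ k.+1 * wquot M k * enorm v ^+ k.
Proof.
have [B [B0 HB]] := wcutoff_derive_bound; have [A [A1 HA]] := wquot_growth regM.
have C0 := C_ge0; have l0 := lam_gt0; have A0 := le_trans ler01 A1.
(* The constants of the two terms, times 2 for the geometric sum. *)
pose C3 := 2 * (B * C + C ^+ 2 * 2).
have C30 : 0 <= C3 by rewrite mulr_ge0// addr_ge0 ?mulr_ge0 ?exprn_ge0.
have C31 : 1 <= C3 + 1 by rewrite lerDr.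
(* C3 + 1 >= 1, so its powers dominate C3; A absorbs the step from m_{k+1} to m_k. *)
pose Q := (C3 + 1) * (2 * lam * A); exists Q.
have lam2 : 0 < 2 * lam by rewrite mulr_gt0.
have Q0 : 0 < Q by rewrite !mulr_gt0 ?(lt_le_trans ltr01 A1)// ltr_wpDl.
split=> // u v k j Vu x0; have v0 : v != 0.
  by apply: contraTneq x0 => ->; rewrite enorm0 ltxx.
have key l : cmod (Lfield X j extension u v) * enorm v <=
    C3 * (wquot M l * (2 * lam * enorm v) ^+ l).
  have y0 : 0 <= wquot M l * (2 * lam * enorm v) ^+ l.
    by rewrite !(mulr_ge0, exprn_ge0, invr_ge0)// ?(regular_M_ge0 regM) ?(ltW l0) ?(ltW x0).
  rewrite Lfield_extension//.
  apply: le_trans (ler_wpM2r (ltW x0) (cmod_sum _ _)) _.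
  rewrite mulr_suml; apply: le_trans (_ : \sum_(k < level M lam v)
    ((B * C + C ^+ 2 * 2) * (wquot M l * (2 * lam * enorm v) ^+ l)) * 2^-1 ^+ k <= _).
    apply: ler_sum => i _; apply: le_trans (ler_wpM2r (ltW x0) (cmodD _ _)) _.
    rewrite mulrDl mulrDl mulrDl; apply: lerD; first exact: Lfield_term1.
    exact: Lfield_term2.
  rewrite -mulr_sumr /C3 [leRHS](_ : _ = (B * C + C ^+ 2 * 2) *
    (wquot M l * (2 * lam * enorm v) ^+ l) * 2); last by ring.
  apply: (ler_wpM2l _ (sum_geom2 _ _)).
  by rewrite mulr_ge0// addr_ge0 ?mulr_ge0 ?exprn_ge0.
(* Using l = k + 1 leaves |v|^k after division by |v|. *)
have := key k.+1.
rewrite [leRHS](_ : _ = C3 * (wquot M k.+1 * (2 * lam) ^+ k.+1 * enorm v ^+ k) * enorm v); last first.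
  by rewrite !exprMn !exprS; ring.
rewrite ler_pM2r// => h; apply: le_trans h _.
rewrite [leLHS]mulrA; apply: ler_wpM2r; first by rewrite exprn_ge0 ?ltW.
apply: le_trans (_ : C3 * (A ^+ k * wquot M k) * (2 * lam) ^+ k.+1 <= _).
  rewrite [leLHS]mulrA; apply: ler_wpM2r; first by rewrite exprn_ge0 ?ltW.
  exact: (ler_wpM2l C30 (HA k)).
rewrite [leLHS](_ : _ = C3 * (A ^+ k * (2 * lam) ^+ k.+1) * wquot M k); last by ring.
apply: ler_wpM2r; first exact/ltW/wquot_gt0.
have -> : Q ^+ k.+1 = (C3 + 1) ^+ k.+1 * (A ^+ k.+1 * (2 * lam) ^+ k.+1).
  by rewrite /Q -!exprMn; congr (_ ^+ _); ring.
have lamk : 0 <= (2 * lam) ^+ k.+1 by rewrite exprn_ge0 ?ltW.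
apply: ler_pM => //; first by rewrite mulr_ge0 // exprn_ge0.
  apply: le_trans (_ : C3 + 1 <= _); first by rewrite lerDl.
  by rewrite exprS ler_peMr ?exprn_ege1// (le_trans ler01).
by apply: ler_wpM2r => //; apply: ler_weXn2l.
Qed.

Lemma asymptotic_extension_extension : exists Q, 0 < Q /\
  asymptotic_extension M X V f 1 Q extension.
Proof.
(* The bound covers every v with [0 < enorm v], so 1 serves as delta. *)
have [Q [Q0 HQ]] := Lfield_bound; exists Q; split=> //; split.
- exact: continuous_extension.
- exact: smooth_extension.
- by move=> u _; exact: extension0.
- by move=> u v k j Vu x0 _; exact: HQ.
Qed.
End extension.

(** * Growth of the coefficients and choice of lam *)

(** What is geometric in k goes into the base: A^kappa from [wquot_shift], and 2 from (k+g)! <= k!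
    g! 2^(k+g). The rest depends on g only and forms the constant. *)
Lemma regular_coef_growth (R : realType) (M : nat -> R) (m : nat) (C A : R)
    (kappa g k : nat) : regular M -> 1 <= C -> 1 <= A ->
  (forall j, wquot M j.+1 <= A ^+ j * wquot M j) -> (g <= kappa)%N ->
  C ^+ (k + g).+1 * M (k + g)%N * m%:R ^+ k / k`!%:R <=
  C ^+ g.+1 * A ^+ (g * g) * (g`!%:R * 2 ^+ g) *
    ((4 * (C * m.+1%:R) * (2 * A ^+ kappa) / 4) ^+ k * wquot M k).
Proof.
move=> regM C1 A1 HA gk; have C0 := le_trans ler01 C1; have A0 := le_trans ler01 A1.
have f0 : (0 : R) < k`!%:R by rewrite ltr0n fact_gt0.
have mk := ltW (wquot_gt0 regM k).
have h1 : wquot M (k + g)%N <= A ^+ kappa ^+ k * A ^+ (g * g) * wquot M k.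
  apply: le_trans (wquot_shift regM A1 HA k g) _.
  apply: (ler_wpM2r mk); rewrite -exprM -exprD mulnDl.
  by apply: ler_weXn2l => //; rewrite leq_add2r mulnC leq_mul2r gk orbT.
have h2 : M (k + g)%N <= (A ^+ kappa ^+ k * A ^+ (g * g) * wquot M k) *
    (k`!%:R * (g`!%:R * 2 ^+ (k + g))).
  rewrite (wquotE M (k + g)); apply: ler_pM => //; last exact: fact_add_le.
  exact/ltW/wquot_gt0.
have h3 : (m%:R : R) ^+ k <= m.+1%:R ^+ k.
  by apply: lerXn2r; rewrite ?nnegrE// ler_nat.
rewrite ler_pdivrMr//.
apply: le_trans (_ : C ^+ (k + g).+1 * ((A ^+ kappa ^+ k * A ^+ (g * g) * wquot M k) *
    (k`!%:R * (g`!%:R * 2 ^+ (k + g)))) * m.+1%:R ^+ k <= _).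
  have Ck : 0 <= C ^+ (k + g).+1 by rewrite exprn_ge0.
  have M0 := regular_M_ge0 regM (k + g).
  apply: ler_pM => //; first exact: mulr_ge0.
  exact: (ler_wpM2l Ck h2).
rewrite le_eqVlt; apply/predU1P; left.
have -> : 4 * (C * m.+1%:R) * (2 * A ^+ kappa) / 4 = C * m.+1%:R * (2 * A ^+ kappa).
  by field.
by rewrite -addnS !exprD [in RHS]exprMn !exprMn; ring.
Qed.

(** The base contains H but not g, so a single lam serves all gamma. *)
Lemma moderate_coef_growth (R : realType) (M : nat -> R) (m : nat) (C H : R)
    (g k : nat) : regular M -> 1 <= C -> 1 <= H ->
  (forall k g, M (k + g)%N <= H ^+ (k + g).+1 * (M k * M g)) ->
  C ^+ (k + g).+1 * M (k + g)%N * m%:R ^+ k / k`!%:R <=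
  C ^+ g.+1 * H ^+ g.+1 * M g *
    ((4 * (C * m.+1%:R) * H / 4) ^+ k * wquot M k).
Proof.
move=> regM C1 H1 HH; have C0 := le_trans ler01 C1; have H0 := le_trans ler01 H1.
have f0 : (0 : R) < k`!%:R by rewrite ltr0n fact_gt0.
have h3 : (m%:R : R) ^+ k <= m.+1%:R ^+ k.
  by apply: lerXn2r; rewrite ?nnegrE// ler_nat.
rewrite ler_pdivrMr//.
apply: le_trans (_ : C ^+ (k + g).+1 * (H ^+ (k + g).+1 * (M k * M g)) *
   m.+1%:R ^+ k <= _).
  have Ck : 0 <= C ^+ (k + g).+1 by rewrite exprn_ge0.
  have M0 := regular_M_ge0 regM (k + g).
  apply: ler_pM => //; first exact: mulr_ge0.
  exact: (ler_wpM2l Ck (HH k g)).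
rewrite le_eqVlt; apply/predU1P; left; rewrite (wquotE M k).
have -> : 4 * (C * m.+1%:R) * H / 4 = C * m.+1%:R * H by field.
by rewrite -addnS !exprD !exprMn; ring.
Qed.

Unset Implicit Arguments.

Theorem theorem2p7 (R : realType) (M : nat -> R) (d m : nat)
    (U : set 'rV[R]_d) (X : 'I_m -> 'rV[R]_d -> 'rV[R[i]]_d)
    (f : 'rV[R]_d -> R[i]) :
  regular M ->
  open U -> U 0 ->
  (forall j : 'I_m, smooth_vfield U (X j)) ->
  (forall i j : 'I_m, commuting_on U (X i) (X j)) ->
  CM_space M U X f ->
  forall V : set 'rV[R]_d, open V -> compactly_contained V U ->
  [/\ exists (delta Q : R) (F : 'rV[R]_d * 'rV[R]_m -> R[i]),
        [/\ 0 < delta, 0 < Q & asymptotic_extension M X V f delta Q F],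
      forall kappa : nat,
        exists (delta Q : R) (F : 'rV[R]_d * 'rV[R]_m -> R[i]),
          [/\ 0 < delta, 0 < Q, asymptotic_extension M X V f delta Q F
            & forall gamma : 'I_m -> nat, (mdeg gamma <= kappa)%N ->
                smooth_in_v X V F gamma]
    & moderate_growth M ->
        exists (delta Q : R) (F : 'rV[R]_d * 'rV[R]_m -> R[i]),
          [/\ 0 < delta, 0 < Q, asymptotic_extension M X V f delta Q F
            & forall gamma : 'I_m -> nat, smooth_in_v X V F gamma]].
Proof.
move=> regM oU _ sX commX fM V oV [cV VU'].
have VU : V `<=` U by apply: subset_trans VU'; exact: subset_closure.
have [C [C1 HC']] := vfield_word_bound oU sX commX (regular_M_ge0 regM) fM cV VU'.
have HC s u : V u -> cmod (vfield_word X s f u) <= C ^+ (size s).+1 * M (size s).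
  by move=> Vu; apply: HC'; exact: subset_closure.
have sf : smooth_on U f by case: fM.
have [A [A1 HA]] := wquot_growth regM.
have C0 := le_trans ler01 C1; have A0 := le_trans ler01 A1.
(* Both choices of lam are the basic value times some t >= 1, namely 2 A^kappa or H. *)
have lam_le t : 1 <= t -> 4 * (C * m.+1%:R) <= 4 * (C * m.+1%:R) * t.
  by move=> t1; rewrite ler_peMr// !mulr_ge0.
have part2 kappa : exists (delta Q : R) (F : 'rV[R]_d * 'rV[R]_m -> R[i]),
    [/\ 0 < delta, 0 < Q, asymptotic_extension M X V f delta Q F
      & forall gamma : 'I_m -> nat, (mdeg gamma <= kappa)%N ->
          smooth_in_v X V F gamma].
  have t1 : 1 <= 2 * A ^+ kappa.
    have h : 1 <= A ^+ kappa by rewrite exprn_ege1.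
    by lra.
  have lamC := lam_le _ t1.
  have [Q [Q0 HQ]] := asymptotic_extension_extension regM oU sX sf oV VU C1 HC lamC commX.
  exists 1, Q; eexists; split; [exact: ltr01|exact: Q0|exact: HQ|move=> gamma gk].
  apply: (smooth_in_v_extension regM oU sX sf oV VU C1 HC lamC
    (D := C ^+ (mdeg gamma).+1 * A ^+ (mdeg gamma * mdeg gamma) *
      ((mdeg gamma)`!%:R * 2 ^+ mdeg gamma))).
    by rewrite !mulr_ge0 ?exprn_ge0.
  by move=> k; exact: regular_coef_growth.
split=> // [|/(moderate_growthP regM)[H [H1 HH]]].
  (* The first claim is contained in the second with kappa = 0. *)
  by have [delta [Q [F [d0 Q0 HF _]]]] := part2 0%N; exists delta, Q, F.
have lamC := lam_le _ H1.
have [Q [Q0 HQ]] := asymptotic_extension_extension regM oU sX sf oV VU C1 HC lamC commX.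
exists 1, Q; eexists; split; [exact: ltr01|exact: Q0|exact: HQ|move=> gamma].
apply: (smooth_in_v_extension regM oU sX sf oV VU C1 HC lamC
  (D := C ^+ (mdeg gamma).+1 * H ^+ (mdeg gamma).+1 * M (mdeg gamma))).
  by rewrite !mulr_ge0 ?exprn_ge0 ?(regular_M_ge0 regM)// (le_trans ler01).
by move=> k; exact: moderate_coef_growth.
Qed.
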